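(* Let $g\in C^{1,\alpha}(\partial B(0,1))$ for some $\alpha\in(0,1)$, viewed as a $2\pi$-periodic function of the angle, where $B(0,1)\subset\mathbb{R}^2$ is the unit disk. Let $u$ be the unique solution of the Dirichlet problem $$\Delta u=0\ \text{in }B(0,1),\qquad u=g\ \text{on }\partial B(0,1).$$ Then for all $r\in(0,1)$ and $\phi\in\mathbb{R}$, $$Du(re^{i\phi})=-\frac1r\Big(\frac1\pi K_r*g'(\phi)\Big)e^{i\phi}+\frac1r\Big(\frac1{2\pi}P_r*g'(\phi)\Big)e^{i(\phi+\frac\pi2)}.$$ If moreover $\int_{-\pi}^{\pi}g\,d\tau=0$ and $w$ is the unique solution of the Neumann problem $$\Delta w=0\ \text{in }B(0,1),\qquad \frac{\partial w}{\partial\nu}=g\ \text{on }\partial B(0,1),\qquad \int_{B(0,1)}w\,dx=0,$$ then for all $r\in(0,1)$ and $\phi\in\mathbb{R}$, $$Dw(re^{i\phi})=\frac1r\Big(\frac1{2\pi}P_r*g(\phi)\Big)e^{i\phi}+\frac1r\Big(\frac1{\pi}K_r*g(\phi)\Big)e^{i(\phi+\frac\pi2)}.$$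
   Context: $\mathbb{R}^2$ is identified with $\mathbb{C}$, gradients are regarded as complex numbers, $\nu$ is the outward unit normal, and $g'$ is the derivative of $g$ with respect to the angle (tangential derivative). The kernels are $$P_r(\phi)=\frac{1-r^2}{r^2+1-2r\cos\phi},\qquad K_r(\phi)=\frac{r\sin\phi}{r^2+1-2r\cos\phi},$$ and the convolution convention is $(P_r*h)(\phi)=\int_{-\pi}^{\pi}P_r(\tau-\phi)h(\tau)\,d\tau$ and $(K_r*h)(\phi)=\int_{-\pi}^{\pi}K_r(\tau-\phi)h(\tau)\,d\tau$ (note the argument $\tau-\phi$, which matters for the odd kernel $K_r$). *)

(* Defs.v *)
From Stdlib Require Export Reals.
From Coquelicot Require Export Coquelicot.
Open Scope R_scope.

(* The plane is identified with C, and C = R * R in Coquelicot; the topology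
   below is the product one.  Functions on the closed disk are modelled by total
   functions on C; no definition constrains their values outside it. *)

Definition cis (t : R) : C := (cos t, sin t).

Definition polar (r t : R) : C := (RtoC r * cis t)%C.

Definition disk (z : C) : Prop := Cmod z < 1.

Definition closed_disk (z : C) : Prop := Cmod z <= 1.

(* [Derive] is total with an unspecified value where there is no derivative, so
   the partial derivatives are meaningful only together with [C1_in]. *)
Definition dx (u : C -> R) (z : C) : R := Derive (fun x => u (x, Im z)) (Re z).

Definition dy (u : C -> R) (z : C) : R := Derive (fun y => u (Re z, y)) (Im z).

Definition grad (u : C -> R) (z : C) : C := (dx u z, dy u z).

Definition laplacian (u : C -> R) (z : C) : R := dx (dx u) z + dy (dy u) z.

Definition C1_in (D : C -> Prop) (u : C -> R) : Prop :=
  forall z, D z ->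
    ex_derive (fun x => u (x, Im z)) (Re z) /\
    ex_derive (fun y => u (Re z, y)) (Im z) /\
    continuous (dx u) z /\ continuous (dy u) z.

Definition C2_in (D : C -> Prop) (u : C -> R) : Prop :=
  C1_in D u /\ C1_in D (dx u) /\ C1_in D (dy u).

Definition harmonic_in (D : C -> Prop) (u : C -> R) : Prop :=
  C2_in D u /\ forall z, D z -> laplacian u z = 0.

(* C^1 up to the boundary: the function is continuous on the closed disk and its
   gradient in the open disk extends continuously to the closed disk. *)
Definition C1_closed_disk (w : C -> R) : Prop :=
  continuous_on closed_disk w /\
  C1_in disk w /\
  exists G : C -> C,
    continuous_on closed_disk G /\ forall z, disk z -> G z = grad w z.

(* The outward unit normal at a point z of the unit circle is z itself, and
   z + t z stays in the closed disk for small t <= 0, whence the one-sided limit. *)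
Definition is_normal_derivative (w : C -> R) (z : C) (l : R) : Prop :=
  filterlim (fun t => (w (z + RtoC t * z)%C - w z) / t) (at_left 0) (locally l).

(* Integral over the disk as an iterated Riemann integral; for a function that is
   continuous on the closed disk this is the area integral, by Fubini. *)
Definition disk_integral (w : C -> R) : R :=
  RInt (fun x => RInt (fun y => w (x, y)) (- sqrt (1 - x ^ 2)) (sqrt (1 - x ^ 2)))
    (-1) 1.

(* C^{1,alpha} functions on the unit circle, as functions of the angle.  The case
   s = t is excluded because Stdlib's [Rpower 0 alpha] is 1 and not 0. *)
Definition C1alpha_circle (alpha : R) (g : R -> R) : Prop :=
  (forall t, g (t + 2 * PI) = g t) /\
  (forall t, ex_derive g t) /\
  exists M : R, forall s t, s <> t ->
    Rabs (Derive g s - Derive g t) <= M * Rpower (Rabs (s - t)) alpha.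

Definition dirichlet_solution (g : R -> R) (u : C -> R) : Prop :=
  harmonic_in disk u /\
  continuous_on closed_disk u /\
  forall t, u (cis t) = g t.

Definition neumann_solution (g : R -> R) (w : C -> R) : Prop :=
  harmonic_in disk w /\
  C1_closed_disk w /\
  (forall t, is_normal_derivative w (cis t) (g t)) /\
  disk_integral w = 0.

Definition P (r phi : R) : R := (1 - r ^ 2) / (r ^ 2 + 1 - 2 * r * cos phi).

Definition K (r phi : R) : R := (r * sin phi) / (r ^ 2 + 1 - 2 * r * cos phi).

(* The kernel is evaluated at tau - phi, not phi - tau. *)
Definition conv (k h : R -> R) (phi : R) : R :=
  RInt (fun tau => k (tau - phi) * h tau) (- PI) PI.

(* Main.v *)
(* In polar coordinates, write V(s,t) for a harmonic function and D = s d/ds, so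
   that D^2 V = - d^2V/dt^2.  Let V1 and V2 be harmonic in the unit disk.  By Green's
   identity the integral over t of (D V1)(xa,t) V2(xb,t) - V1(xa,t) (D V2)(xb,t) does
   not depend on x, and it tends to 0 with x; so it vanishes.  This says both that D
   may be moved from one factor to the other, and that the integral of V1(a,t) V2(b,t)
   depends only on the product ab.  For V1 = P(.,t - phi), letting a tend to 1 yields
   the Poisson formula 2 pi V(ab,phi) = int P_a(t - phi) V(b,t) dt for b < 1, without a
   maximum principle.  Differentiate it in a and phi, using the conjugacy relations
   D P = 2 dK/dt and dP/dt = - 2 D K, and let b tend to 1 with ab = r fixed.  In the
   Dirichlet case t-derivatives of the kernel are then integrated by parts onto g; in
   the Neumann case D is first moved from the kernel to w, and D w tends to g. *)

Require Import Defs.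
From Stdlib Require Import Reals Lra Lia.
From Coquelicot Require Import Coquelicot.
Open Scope R_scope.

(** * Integrals depending on a parameter *)

(** Two places resist differentiation. The unit circle is one: the solution is merely continuous
    there, so every identity is proved at two radii below 1 and the boundary data enter in one final
    limit. In it the harmonic function is taken at radius [b] and the kernel at [r / b], which stays
    below 1, so the kernel is never singular. The origin is the other: polar coordinates degenerate
    at it, so it is reached by continuity alone, and [s d/ds] replaces [d/ds] because it stays
    regular and vanishes at radius 0. The conjugacy relations are the Cauchy-Riemann equations of (1
    + z) / (1 - z) = P + 2 i K with z = r e^(it). The factor 2 in front of K is why 1/PI accompanies
    K in the result where 1/(2 PI) accompanies P. The signs come from the argument t - phi, since a
    derivative in phi is minus a derivative in t, and from integrating by parts. *)

Lemma is_derive_continuous (f : R -> R) (x l : R) :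
  is_derive f x l -> continuous f x.
Proof.
  intros H. apply (ex_derive_continuous (K := R_AbsRing) (V := R_NormedModule)).
  exists l. exact H.
Qed.

(** The derivative is asked for in the open interval only, because one endpoint will be radius 0,
    where the polar formulas divide by zero. *)
Lemma null_derivative_eq (f : R -> R) (a b : R) :
  a <= b ->
  (forall x, a < x < b -> is_derive f x 0) ->
  (forall x, a <= x <= b -> continuous f x) ->
  f a = f b.
Proof.
  intros Hab Hd Hc.
  destruct (MVT_gen f a b (fun _ => 0)) as [c [_ H]].
  - rewrite Rmin_left, Rmax_right by exact Hab. exact Hd.
  - rewrite Rmin_left, Rmax_right by exact Hab.
    intros x Hx. apply continuity_pt_filterlim. exact (Hc x Hx).
  - lra.
Qed.

Lemma continuity_2d_pt_section_r (f : R -> R -> R) (x t : R) :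
  continuity_2d_pt f x t -> continuous (f x) t.
Proof.
  intros H. apply continuity_pt_filterlim.
  apply continuity_pt_locally. intros eps.
  destruct (H eps) as [d Hd]. exists d. intros y Hy.
  apply Hd; [rewrite Rminus_diag, Rabs_R0; apply cond_pos | exact Hy].
Qed.

Lemma continuity_2d_pt_section_l (f : R -> R -> R) (x t : R) :
  continuity_2d_pt f x t -> continuous (fun x => f x t) x.
Proof.
  intros H. apply continuity_pt_filterlim.
  apply continuity_pt_locally. intros eps.
  destruct (H eps) as [d Hd]. exists d. intros y Hy.
  apply Hd; [exact Hy | rewrite Rminus_diag, Rabs_R0; apply cond_pos].
Qed.

Lemma ex_RInt_continuous_on (f : R -> R) (a b : R) :
  (forall t, continuous f t) -> ex_RInt f a b.
Proof. intros H. apply (ex_RInt_continuous (V := R_CompleteNormedModule)). auto. Qed.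

Lemma continuous_RInt_param (f : R -> R -> R) (a b x : R) :
  a <= b ->
  (forall t, continuity_2d_pt f x t) ->
  locally x (fun y => forall t, continuous (f y) t) ->
  continuous (fun y => RInt (f y) a b) x.
Proof.
  intros Hab Hf Hc. apply continuity_pt_filterlim.
  apply continuity_pt_locally. intros eps.
  (* The [+ 1] keeps the divisor positive when [a = b] and makes the final bound strict. *)
  assert (He : 0 < eps / (b - a + 1)).
  { apply Rdiv_lt_0_compat; [apply cond_pos | lra]. }
  destruct (uniform_continuity_2d_1d' f a b x (fun t _ => Hf t) (mkposreal _ He))
    as [d Hd].
  assert (Hd0 := cond_pos d).
  assert (Hx := locally_singleton _ _ Hc).
  generalize (filter_and _ _ Hc (locally_ball x d)). apply filter_imp.
  intros y [Hy1 Hy2].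
  change (Rabs (y - x) < d) in Hy2.
  assert (E : RInt (f y) a b - RInt (f x) a b = RInt (fun t => f y t - f x t) a b).
  { symmetry. apply (RInt_minus (V := R_CompleteNormedModule));
      apply ex_RInt_continuous_on; assumption. }
  rewrite E.
  apply Rle_lt_trans with ((b - a) * (eps / (b - a + 1))).
  - apply abs_RInt_le_const; [exact Hab | | ].
    + apply ex_RInt_continuous_on. intros t.
      apply (continuous_minus (V := R_NormedModule)); auto.
    + intros t Ht. apply Rlt_le.
      apply (Hd t x t y); try assumption; try lra.
      * apply Rabs_def2 in Hy2. lra.
      * rewrite Rminus_diag, Rabs_R0. exact Hd0.
  - assert (0 < eps) by apply cond_pos.
    apply Rmult_lt_reg_r with (b - a + 1); [lra|].
    replace ((b - a) * (eps / (b - a + 1)) * (b - a + 1)) with ((b - a) * eps)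
      by (field; lra).
    nra.
Qed.

(** Differentiation under the integral with the partial derivative supplied as an explicit function
    [d], so that joint continuity is checked on a formula instead of on [Derive]. *)
Lemma is_derive_RInt_param' (f d : R -> R -> R) (a b x : R) :
  locally x (fun y => forall t, is_derive (fun z => f z t) y (d y t)) ->
  (forall t, continuity_2d_pt d x t) ->
  locally x (fun y => forall t, continuous (f y) t) ->
  is_derive (fun y => RInt (f y) a b) x (RInt (d x) a b).
Proof.
  intros Hd Hc Hf.
  assert (E : RInt (d x) a b = RInt (fun t => Derive (fun z => f z t) x) a b).
  { apply RInt_ext. intros t _. symmetry. apply is_derive_unique.
    exact (locally_singleton _ _ Hd t). }
  rewrite E. apply is_derive_RInt_param.
  - revert Hd. apply filter_imp. intros y H t _. exists (d y t). apply H.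
  - intros t _. apply continuity_2d_pt_ext_loc with (2 := Hc t).
    destruct Hd as [e He]. exists e. intros u v Hu _.
    symmetry. apply is_derive_unique. apply He. exact Hu.
  - revert Hf. apply filter_imp. intros y H. apply ex_RInt_continuous_on. exact H.
Qed.

Lemma RInt_derivative_periodic (h d : R -> R) (a b : R) :
  (forall t, is_derive h t (d t)) -> (forall t, continuous d t) -> h a = h b ->
  RInt d a b = 0.
Proof.
  intros Hh Hd Hp. apply is_RInt_unique.
  replace 0 with (minus (h b) (h a)).
  - apply (is_RInt_derive (V := R_CompleteNormedModule)); auto.
  - rewrite Hp. apply (minus_eq_zero (G := R_AbelianGroup)).
Qed.

Lemma RInt_by_parts_periodic (f g df dg : R -> R) (a b : R) :
  (forall t, is_derive f t (df t)) -> (forall t, is_derive g t (dg t)) ->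
  (forall t, continuous df t) -> (forall t, continuous dg t) ->
  f a * g a = f b * g b ->
  RInt (fun t => f t * dg t) a b = - RInt (fun t => df t * g t) a b.
Proof.
  intros Hf Hg Hdf Hdg Hp.
  assert (Cf : forall t, continuous f t).
  { intros t. eapply is_derive_continuous, Hf. }
  assert (Cg : forall t, continuous g t).
  { intros t. eapply is_derive_continuous, Hg. }
  assert (C1 : forall t, continuous (fun t => df t * g t) t)
    by (intros t; apply (continuous_mult (K := R_AbsRing)); auto).
  assert (C2 : forall t, continuous (fun t => f t * dg t) t)
    by (intros t; apply (continuous_mult (K := R_AbsRing)); auto).
  enough (H : RInt (fun t => df t * g t) a b + RInt (fun t => f t * dg t) a b = 0) by lra.
  rewrite <- (RInt_derivative_periodic (fun t => f t * g t)
    (fun t => df t * g t + f t * dg t) a b).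
  - symmetry. apply (RInt_plus (V := R_CompleteNormedModule));
      apply ex_RInt_continuous_on; assumption.
  - intros t. apply (is_derive_mult (K := R_AbsRing)); auto. intros; apply Rmult_comm.
  - intros t. apply (continuous_plus (V := R_NormedModule)); auto.
  - exact Hp.
Qed.

(** The integral over a translated period has zero derivative in the translation: that derivative is
    the integral of [dp] over one period, hence a difference of two equal values of [p]. *)
Lemma RInt_shift_periodic (p dp : R -> R) (phi : R) :
  (forall t, is_derive p t (dp t)) -> (forall t, continuous dp t) ->
  (forall t, p (t + 2 * PI) = p t) ->
  RInt p (- PI) PI = RInt (fun t => p (phi + t)) (- PI) PI.
Proof.
  intros Hp Hdp Hper.
  transitivity (RInt (fun t => p (0 + t)) (- PI) PI).
  { apply RInt_ext. intros t _. now rewrite Rplus_0_l. }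
  assert (D : forall x, is_derive (fun x => RInt (fun t => p (x + t)) (- PI) PI) x 0).
  { intros x.
    assert (Hs : forall y t, is_derive (fun z => p (z + t)) y (dp (y + t))).
    { intros y t. replace (dp (y + t)) with (1 * dp (y + t)) by ring.
      apply (is_derive_comp (K := R_AbsRing) (V := R_NormedModule) p (fun z => z + t)).
      - apply Hp.
      - auto_derive; trivial. }
    rewrite <- (RInt_derivative_periodic (fun t => p (x + t)) (fun t => dp (x + t)) (- PI) PI).
    - apply (is_derive_RInt_param' (fun x t => p (x + t)) (fun x t => dp (x + t))).
      + apply filter_forall. exact Hs.
      + intros t. apply (continuity_1d_2d_pt_comp dp (fun x t => x + t)).
        * apply continuity_pt_filterlim. apply Hdp.
        * apply continuity_2d_pt_plus;
            [apply continuity_2d_pt_id1 | apply continuity_2d_pt_id2].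
      + apply filter_forall. intros y t.
        eapply is_derive_continuous. apply is_derive_ext with (fun t => p (t + y)).
        * intros s; f_equal; ring.
        * apply Hs.
    - intros t. apply is_derive_ext with (fun t => p (t + x)).
      + intros s; f_equal; ring.
      + rewrite (Rplus_comm x t). apply Hs.
    - intros t. apply (continuous_comp (fun t => x + t) dp).
      + apply (continuous_plus (V := R_NormedModule));
          [apply continuous_const | apply continuous_id].
      + apply Hdp.
    - rewrite <- (Hper (x + - PI)). f_equal. ring. }
  destruct (Rle_dec 0 phi) as [H | H].
  - apply (null_derivative_eq (fun x => RInt (fun t => p (x + t)) (- PI) PI)); auto.
    intros x _. eapply is_derive_continuous, D.
  - symmetry.
    apply (null_derivative_eq (fun x => RInt (fun t => p (x + t)) (- PI) PI)); auto; try lra.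
    intros x _. eapply is_derive_continuous, D.
Qed.

Lemma RInt_odd (f : R -> R) (a : R) :
  (forall t, continuous f t) -> (forall t, f (- t) = - f t) ->
  RInt f (- a) a = 0.
Proof.
  intros Hc Ho.
  assert (H : RInt (fun y => scal (-1) (f (- y))) (- a) a = RInt f (- - a) (- a)).
  { apply (RInt_comp (V := R_CompleteNormedModule) f Ropp (fun _ => -1)).
    - auto.
    - intros x _. split; [auto_derive; trivial; ring | apply continuous_const]. }
  rewrite (RInt_ext _ f) in H.
  - rewrite Ropp_involutive in H.
    rewrite <- (opp_RInt_swap (V := R_CompleteNormedModule) f (- a) a) in H
      by (apply ex_RInt_continuous_on; auto).
    change (RInt f (- a) a = - RInt f (- a) a) in H. lra.
  - intros x _. rewrite Ho. change (-1 * - f x = f x). ring.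
Qed.

(** * Green's identity in polar coordinates *)

Lemma continuity_2d_pt_comp_l (V : R -> R -> R) (g : R -> R) (x t : R) :
  continuous g x -> continuity_2d_pt V (g x) t ->
  continuity_2d_pt (fun x t => V (g x) t) x t.
Proof.
  intros Hg HV eps. destruct (HV eps) as [d Hd].
  destruct (proj1 (filterlim_locally _ _) Hg d) as [e He].
  assert (Hm : 0 < Rmin d e) by (apply Rmin_glb_lt; apply cond_pos).
  exists (mkposreal _ Hm). simpl. intros u v Hu Hv. apply Hd.
  - apply (He u). apply Rlt_le_trans with (1 := Hu). apply Rmin_r.
  - apply Rlt_le_trans with (1 := Hv). apply Rmin_l.
Qed.

Lemma locally_open_interval (a b x : R) (Q : R -> Prop) :
  a < x < b -> (forall y, a < y < b -> Q y) -> locally x Q.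
Proof.
  intros Hx HQ.
  assert (H : locally x (fun y => Rbar_lt a y /\ Rbar_lt y b)).
  { apply (locally_interval _ x a b); simpl; try apply Hx. intros y H1 H2. now split. }
  revert H. apply filter_imp. intros y H. apply HQ. exact H.
Qed.

Lemma is_derive_comp_l (V : R -> R -> R) (g : R -> R) (x t dV dg : R) :
  is_derive (fun s => V s t) (g x) dV -> is_derive g x dg ->
  is_derive (fun x => V (g x) t) x (dg * dV).
Proof.
  intros HV Hg.
  exact (is_derive_comp (K := R_AbsRing) (V := R_NormedModule)
           (fun s => V s t) g x dV dg HV Hg).
Qed.

(* [V] is a harmonic function of [s e^(it)] in the unit disk, with
   [A = s dV/ds], [B = dV/dt] and [C = d^2V/dt^2 = - (s d/ds)^2 V]. *)
Record polar_harmonic (V A B C : R -> R -> R) : Prop := {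
  ph_radial : forall s t, 0 < s < 1 -> is_derive (fun s => V s t) s (A s t / s);
  ph_angular : forall s t, 0 < s < 1 -> is_derive (V s) t (B s t);
  ph_radial2 : forall s t, 0 < s < 1 -> is_derive (fun s => A s t) s (- C s t / s);
  ph_angular2 : forall s t, 0 < s < 1 -> is_derive (B s) t (C s t);
  ph_cont_V : forall s t, -1 < s < 1 -> continuity_2d_pt V s t;
  ph_cont_A : forall s t, -1 < s < 1 -> continuity_2d_pt A s t;
  ph_cont_B : forall s t, -1 < s < 1 -> continuity_2d_pt B s t;
  ph_cont_C : forall s t, -1 < s < 1 -> continuity_2d_pt C s t;
  ph_A_0 : forall t, A 0 t = 0;
  ph_per_V : forall s t, V s (t + 2 * PI) = V s t;
  ph_per_B : forall s t, B s (t + 2 * PI) = B s t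
}.

Lemma is_derive_minus_R (f g : R -> R) (x df dg : R) :
  is_derive f x df -> is_derive g x dg -> is_derive (fun x => f x - g x) x (df - dg).
Proof. intros Hf Hg. exact (is_derive_minus (V := R_NormedModule) f g x df dg Hf Hg). Qed.

Lemma is_derive_mult_R (f g : R -> R) (x df dg : R) :
  is_derive f x df -> is_derive g x dg ->
  is_derive (fun x => f x * g x) x (df * g x + f x * dg).
Proof.
  intros Hf Hg. apply (is_derive_mult (K := R_AbsRing)); auto. intros; apply Rmult_comm.
Qed.

Lemma is_derive_scale (a x : R) : is_derive (fun x => a * x) x a.
Proof. auto_derive; trivial. ring. Qed.

Section Green.

Variables V1 A1 B1 C1 V2 A2 B2 C2 : R -> R -> R.
Hypothesis H1 : polar_harmonic V1 A1 B1 C1.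
Hypothesis H2 : polar_harmonic V2 A2 B2 C2.

Lemma continuity_2d_pt_mult_scaled (F G : R -> R -> R) (f g : R -> R) (x t : R) :
  continuous f x -> continuous g x ->
  continuity_2d_pt F (f x) t -> continuity_2d_pt G (g x) t ->
  continuity_2d_pt (fun x t => F (f x) t * G (g x) t) x t.
Proof.
  intros Hf Hg HF HG. apply continuity_2d_pt_mult.
  - now apply (continuity_2d_pt_comp_l F).
  - now apply (continuity_2d_pt_comp_l G).
Qed.

(* The integral of [A1 V2 - V1 A2] over the circles of radii [x a] and [x b] does
   not depend on [x], by Green's second identity, and vanishes for [x = 0]. *)
Lemma polar_green (a b : R) : 0 < a < 1 -> 0 < b < 1 ->
  RInt (fun t => A1 a t * V2 b t - V1 a t * A2 b t) (- PI) PI = 0.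
Proof.
  intros Ha Hb.
  pose (q := fun x t => A1 (a * x) t * V2 (b * x) t - V1 (a * x) t * A2 (b * x) t).
  (* In the x-derivative of [q] the two products [A1 A2] cancel, and what is left is exactly the
     t-derivative of the periodic function [e], so it integrates to zero over the circle. *)
  pose (d := fun x t =>
    / x * (V1 (a * x) t * C2 (b * x) t - C1 (a * x) t * V2 (b * x) t)).
  pose (e := fun x t =>
    / x * (V1 (a * x) t * B2 (b * x) t - B1 (a * x) t * V2 (b * x) t)).
  (* For |x| < T both radii [a * x] and [b * x] stay inside the disk; as T > 1, both 0 and 1 are
     interior points of the parameter range. *)
  pose (T := Rmin (/ a) (/ b)).
  assert (HT : 1 < T).
  { apply Rmin_glb_lt; rewrite <- Rinv_1; apply Rinv_lt_contravar; lra. }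
  assert (Hax : forall x, -T < x < T -> -1 < a * x < 1).
  { intros x Hx. assert (T <= / a) by apply Rmin_l.
    assert (a * / a = 1) by (field; lra). nra. }
  assert (Hbx : forall x, -T < x < T -> -1 < b * x < 1).
  { intros x Hx. assert (T <= / b) by apply Rmin_r.
    assert (b * / b = 1) by (field; lra). nra. }
  assert (Hsc : forall c x, continuous (fun x => c * x) x).
  { intros c x. eapply is_derive_continuous, is_derive_scale. }
  assert (Cq : forall x t, -T < x < T -> continuity_2d_pt q x t).
  { intros x t Hx. apply continuity_2d_pt_minus;
      apply (continuity_2d_pt_mult_scaled _ _ (fun x => a * x) (fun x => b * x)); auto;
      first [apply (ph_cont_A _ _ _ _ H1) | apply (ph_cont_V _ _ _ _ H1)
            | apply (ph_cont_A _ _ _ _ H2) | apply (ph_cont_V _ _ _ _ H2)]; auto. }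
  assert (Cd : forall x t, 0 < x < T -> continuity_2d_pt d x t).
  { intros x t Hx. apply continuity_2d_pt_mult.
    { apply (continuity_2d_pt_inv (fun x _ => x)); [apply continuity_2d_pt_id1 | lra]. }
    apply continuity_2d_pt_minus;
      apply (continuity_2d_pt_mult_scaled _ _ (fun x => a * x) (fun x => b * x)); auto;
      first [apply (ph_cont_C _ _ _ _ H1) | apply (ph_cont_V _ _ _ _ H1)
            | apply (ph_cont_C _ _ _ _ H2) | apply (ph_cont_V _ _ _ _ H2)];
      first [apply Hax | apply Hbx]; lra. }
  assert (Dq : forall x t, 0 < x < T -> is_derive (fun x => q x t) x (d x t)).
  { intros x t Hx.
    assert (Ia : 0 < a * x < 1) by (assert (-1 < a * x < 1) by (apply Hax; lra); nra).
    assert (Ib : 0 < b * x < 1) by (assert (-1 < b * x < 1) by (apply Hbx; lra); nra).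
    replace (d x t) with
      ((a * (- C1 (a * x) t / (a * x)) * V2 (b * x) t
        + A1 (a * x) t * (b * (A2 (b * x) t / (b * x))))
       - (a * (A1 (a * x) t / (a * x)) * A2 (b * x) t
        + V1 (a * x) t * (b * (- C2 (b * x) t / (b * x)))))
      by (unfold d; field; lra).
    apply (is_derive_minus_R (fun x => A1 (a * x) t * V2 (b * x) t)
                             (fun x => V1 (a * x) t * A2 (b * x) t));
      [ apply (is_derive_mult_R (fun x => A1 (a * x) t) (fun x => V2 (b * x) t))
      | apply (is_derive_mult_R (fun x => V1 (a * x) t) (fun x => A2 (b * x) t)) ];
      [ apply (is_derive_comp_l A1 (fun x => a * x)) | apply (is_derive_comp_l V2 (fun x => b * x))
      | apply (is_derive_comp_l V1 (fun x => a * x)) | apply (is_derive_comp_l A2 (fun x => b * x))];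
      try apply is_derive_scale;
      first [now apply (ph_radial2 _ _ _ _ H1) | now apply (ph_radial _ _ _ _ H1)
            | now apply (ph_radial2 _ _ _ _ H2) | now apply (ph_radial _ _ _ _ H2)]. }
  assert (De : forall x t, 0 < x < T -> is_derive (e x) t (d x t)).
  { intros x t Hx.
    assert (Ia : 0 < a * x < 1) by (assert (-1 < a * x < 1) by (apply Hax; lra); nra).
    assert (Ib : 0 < b * x < 1) by (assert (-1 < b * x < 1) by (apply Hbx; lra); nra).
    replace (d x t) with
      (/ x * ((B1 (a * x) t * B2 (b * x) t + V1 (a * x) t * C2 (b * x) t)
       - (C1 (a * x) t * V2 (b * x) t + B1 (a * x) t * B2 (b * x) t)))
      by (unfold d; ring).
    apply (is_derive_scal (fun t => V1 (a * x) t * B2 (b * x) t - B1 (a * x) t * V2 (b * x) t)).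
    apply (is_derive_minus_R (fun t => V1 (a * x) t * B2 (b * x) t)
                             (fun t => B1 (a * x) t * V2 (b * x) t));
      [ apply (is_derive_mult_R (V1 (a * x)) (B2 (b * x)))
      | apply (is_derive_mult_R (B1 (a * x)) (V2 (b * x))) ];
      first [now apply (ph_angular2 _ _ _ _ H1) | now apply (ph_angular _ _ _ _ H1)
            | now apply (ph_angular2 _ _ _ _ H2) | now apply (ph_angular _ _ _ _ H2)]. }
  assert (Z : forall x, 0 < x < T -> RInt (d x) (- PI) PI = 0).
  { intros x Hx. apply RInt_derivative_periodic with (e x).
    - intros t. now apply De.
    - intros t. now apply continuity_2d_pt_section_r, Cd.
    - replace PI with (- PI + 2 * PI) at 2 by ring. unfold e.
      now rewrite !(ph_per_V _ _ _ _ H1), !(ph_per_V _ _ _ _ H2),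
        !(ph_per_B _ _ _ _ H1), !(ph_per_B _ _ _ _ H2). }
  assert (Lq : forall x, -T < x < T -> locally x (fun y => forall t, continuous (q y) t)).
  { intros x Hx. apply locally_open_interval with (1 := Hx). intros y Hy t.
    now apply continuity_2d_pt_section_r, Cq. }
  transitivity (RInt (q 1) (- PI) PI).
  { apply RInt_ext. intros t _. unfold q. now rewrite !Rmult_1_r. }
  (* [d] carries the factor [/ x], so the derivative is used on (0, 1) and the value at 0 is reached
     by continuity of [q]. *)
  transitivity (RInt (q 0) (- PI) PI).
  - symmetry. apply (null_derivative_eq (fun x => RInt (q x) (- PI) PI)); [lra | |].
    + intros x Hx. rewrite <- (Z x) by lra. apply is_derive_RInt_param'.
      * apply locally_open_interval with 0 T; [lra|]. intros y Hy t. now apply Dq.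
      * intros t. apply Cd. lra.
      * apply Lq. lra.
    + intros x Hx. apply continuous_RInt_param.
      * assert (H := PI_RGT_0). lra.
      * intros t. apply Cq. lra.
      * apply Lq. lra.
  - transitivity (RInt (fun _ => 0) (- PI) PI).
    + apply RInt_ext. intros t _. unfold q. rewrite !Rmult_0_r.
      rewrite (ph_A_0 _ _ _ _ H1), (ph_A_0 _ _ _ _ H2), Rmult_0_l, Rmult_0_r.
      apply Rminus_0_r.
    + rewrite RInt_const. apply (scal_zero_r (V := R_ModuleSpace)).
Qed.

Lemma continuous_RInt_product (f g : R -> R) (x : R) :
  continuous f x -> continuous g x ->
  locally x (fun y => -1 < f y < 1 /\ -1 < g y < 1) ->
  continuous (fun y => RInt (fun t => V1 (f y) t * V2 (g y) t) (- PI) PI) x.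
Proof.
  intros Hf Hg HL. assert (Hp := PI_RGT_0).
  apply (continuous_RInt_param (fun y t => V1 (f y) t * V2 (g y) t)); [lra | |].
  - intros t. destruct (locally_singleton _ _ HL).
    apply (continuity_2d_pt_mult_scaled V1 V2 f g); auto.
    + now apply (ph_cont_V _ _ _ _ H1).
    + now apply (ph_cont_V _ _ _ _ H2).
  - revert HL. apply filter_imp. intros y [I1 I2] t.
    apply (continuous_mult (K := R_AbsRing)).
    + apply continuity_2d_pt_section_r. now apply (ph_cont_V _ _ _ _ H1).
    + apply continuity_2d_pt_section_r. now apply (ph_cont_V _ _ _ _ H2).
Qed.

(** Applying z d/dz to V1(z,t) V2(c/z,t) gives [A1 V2 - V1 A2] at the radii z and c/z, whose
    integral vanishes by [polar_green]. *)
Lemma polar_product_invariant (c x y : R) : 0 < c -> c < x < 1 -> c < y < 1 ->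
  RInt (fun t => V1 x t * V2 (c / x) t) (- PI) PI
  = RInt (fun t => V1 y t * V2 (c / y) t) (- PI) PI.
Proof.
  intros Hc.
  assert (I : forall z, c < z < 1 -> 0 < c / z < 1).
  { intros z Hz. split; [apply Rdiv_lt_0_compat; lra|].
    apply Rmult_lt_reg_r with z; [lra|]. unfold Rdiv.
    rewrite Rmult_assoc, Rinv_l; lra. }
  assert (Dg : forall z, c < z < 1 -> is_derive (fun z => c / z) z (- c / z ^ 2)).
  { intros z Hz. auto_derive; [lra|]. field. lra. }
  pose (q := fun z t => V1 z t * V2 (c / z) t).
  pose (d := fun z t => / z * (A1 z t * V2 (c / z) t - V1 z t * A2 (c / z) t)).
  assert (D : forall z, c < z < 1 -> is_derive (fun z => RInt (q z) (- PI) PI) z 0).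
  { intros z Hz.
    assert (Z : RInt (d z) (- PI) PI = 0).
    { unfold d.
      rewrite (RInt_scal (V := R_CompleteNormedModule)
        (fun t => A1 z t * V2 (c / z) t - V1 z t * A2 (c / z) t)).
      - rewrite polar_green; [|lra|now apply I]. apply (scal_zero_r (V := R_ModuleSpace)).
      - apply ex_RInt_continuous_on. intros t.
        destruct (I z Hz).
        apply (continuous_minus (V := R_NormedModule));
          apply (continuous_mult (K := R_AbsRing)); apply continuity_2d_pt_section_r;
          first [apply (ph_cont_A _ _ _ _ H1) | apply (ph_cont_V _ _ _ _ H1)
            | apply (ph_cont_A _ _ _ _ H2) | apply (ph_cont_V _ _ _ _ H2)]; lra. }
    rewrite <- Z. apply is_derive_RInt_param'.
    - apply locally_open_interval with c 1; [exact Hz|]. intros w Hw t.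
      destruct (I w Hw).
      replace (d w t) with
        (A1 w t / w * V2 (c / w) t
         + V1 w t * ((- c / w ^ 2) * (A2 (c / w) t / (c / w))))
        by (unfold d; field; lra).
      apply (is_derive_mult_R (fun w => V1 w t) (fun w => V2 (c / w) t)).
      + apply (ph_radial _ _ _ _ H1). lra.
      + apply (is_derive_comp_l V2 (fun w => c / w)); [|now apply Dg].
        apply (ph_radial _ _ _ _ H2). now apply I.
    - intros t. destruct (I z Hz). apply continuity_2d_pt_mult.
      { apply (continuity_2d_pt_inv (fun x _ => x)); [apply continuity_2d_pt_id1 | lra]. }
      apply continuity_2d_pt_minus;
        apply (continuity_2d_pt_mult_scaled _ _ (fun w => w) (fun w => c / w));
        try apply continuous_id; try (eapply is_derive_continuous; now apply Dg);
        first [apply (ph_cont_A _ _ _ _ H1) | apply (ph_cont_V _ _ _ _ H1)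
            | apply (ph_cont_A _ _ _ _ H2) | apply (ph_cont_V _ _ _ _ H2)]; lra.
    - apply locally_open_interval with c 1; [exact Hz|]. intros w Hw t.
      destruct (I w Hw).
      apply (continuous_mult (K := R_AbsRing)); apply continuity_2d_pt_section_r;
        first [apply (ph_cont_V _ _ _ _ H1) | apply (ph_cont_V _ _ _ _ H2)]; lra. }
  assert (M : forall x y, c < x < 1 -> c < y < 1 -> x <= y ->
    RInt (q x) (- PI) PI = RInt (q y) (- PI) PI).
  { intros x' y' Hx Hy Hxy.
    apply (null_derivative_eq (fun z => RInt (q z) (- PI) PI)); [exact Hxy | |].
    - intros z Hz. apply D. lra.
    - intros z Hz. eapply is_derive_continuous, D. lra. }
  intros Hx Hy. destruct (Rle_dec x y) as [H | H].
  - now apply M.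
  - symmetry. apply M; auto; lra.
Qed.

End Green.

(** * The Poisson kernel and its conjugate *)

Lemma kernel_denominator_pos (r t : R) : -1 < r < 1 -> 0 < r ^ 2 + 1 - 2 * r * cos t.
Proof.
  intros Hr. assert (H := COS_bound t).
  (* A convex combination of (1 + r)^2 and (1 - r)^2 with weights (1 - cos t)/2 and (1 + cos
     t)/2. *)
  replace (r ^ 2 + 1 - 2 * r * cos t)
    with (((1 - cos t) * (1 + r) ^ 2 + (1 + cos t) * (1 - r) ^ 2) / 2) by field.
  assert (0 < (1 + r) ^ 2) by (apply pow_lt; lra).
  assert (0 < (1 - r) ^ 2) by (apply pow_lt; lra).
  destruct (Rle_dec 0 (cos t)); nra.
Qed.

(** The angular derivative of [K], with sin^2 eliminated; [2 * KT] is at the same time r dP/dr. *)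
Definition KT (r t : R) : R :=
  r * ((1 + r ^ 2) * cos t - 2 * r) / (r ^ 2 + 1 - 2 * r * cos t) ^ 2.

Definition PT (r t : R) : R :=
  - (1 - r ^ 2) * (2 * r * sin t) / (r ^ 2 + 1 - 2 * r * cos t) ^ 2.

(* The second angular derivatives, with [sin t ^ 2] written as [1 - cos t ^ 2]. *)
Definition PTT (r t : R) : R :=
  - (1 - r ^ 2) * (2 * r) *
  (cos t * (r ^ 2 + 1 - 2 * r * cos t) - 4 * r * (1 - cos t ^ 2))
  / (r ^ 2 + 1 - 2 * r * cos t) ^ 3.

Definition KTT (r t : R) : R :=
  - r * sin t * ((1 + r ^ 2) * (r ^ 2 + 1 - 2 * r * cos t)
                 + 4 * r * ((1 + r ^ 2) * cos t - 2 * r))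
  / (r ^ 2 + 1 - 2 * r * cos t) ^ 3.

Ltac continuity_2d :=
  unfold Rdiv; cbn [pow];
  repeat first
    [ apply continuity_2d_pt_const | apply continuity_2d_pt_id1
    | apply continuity_2d_pt_id2 | apply continuity_2d_pt_plus
    | apply continuity_2d_pt_minus | apply continuity_2d_pt_opp
    | apply continuity_2d_pt_mult
    | apply (continuity_1d_2d_pt_comp cos); [apply continuity_cos|]
    | apply (continuity_1d_2d_pt_comp sin); [apply continuity_sin|]
    | apply continuity_2d_pt_inv ].

Ltac kernel_side :=
  repeat split; trivial; try (cbn [pow] in *; (lra || (apply Rgt_not_eq; nra))).

Section Kernel_derivatives.

Variables r t : R.
Hypothesis Hr : -1 < r < 1.

Let N_pos := kernel_denominator_pos r t Hr.

Lemma sin_sqr : sin t * sin t = 1 - cos t ^ 2.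
Proof. assert (H := sin2_cos2 t). unfold Rsqr in H. nra. Qed.

Lemma is_derive_P_t : is_derive (P r) t (PT r t).
Proof.
  unfold P, PT. assert (H := N_pos).
  auto_derive.
  - kernel_side.
  - field. lra.
Qed.

Lemma is_derive_K_t : is_derive (K r) t (KT r t).
Proof.
  unfold K, KT. assert (H := N_pos). assert (S := sin_sqr).
  auto_derive.
  - kernel_side.
  - transitivity ((r * cos t * (r ^ 2 + 1 - 2 * r * cos t) - r * r * 2 * (sin t * sin t))
                  / (r ^ 2 + 1 - 2 * r * cos t) ^ 2).
    + field. lra.
    + rewrite S. field. lra.
Qed.

Lemma is_derive_PT_t : is_derive (PT r) t (PTT r t).
Proof.
  unfold PT, PTT. assert (H := N_pos). assert (S := sin_sqr).
  auto_derive.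
  - kernel_side.
  - transitivity (- (1 - r ^ 2) * (2 * r) *
      (cos t * (r ^ 2 + 1 - 2 * r * cos t) - 4 * r * (sin t * sin t))
      / (r ^ 2 + 1 - 2 * r * cos t) ^ 3).
    + field. lra.
    + rewrite S. reflexivity.
Qed.

Lemma is_derive_KT_t : is_derive (KT r) t (KTT r t).
Proof.
  unfold KT, KTT. assert (H := N_pos).
  auto_derive.
  - kernel_side.
  - field. lra.
Qed.

Hypothesis Hr0 : r <> 0.

(** This and the next lemma are the polar Cauchy-Riemann equations of (1 + z) / (1 - z) = P + 2 i K.
    The two after them are the t-derivatives of these equations. *)
Lemma is_derive_P_r : is_derive (fun r => P r t) r (2 * KT r t / r).
Proof.
  unfold P, KT. assert (H := N_pos).
  auto_derive.
  - kernel_side.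
  - field. lra.
Qed.

Lemma is_derive_K_r : is_derive (fun r => K r t) r (- / 2 * PT r t / r).
Proof.
  unfold K, PT. assert (H := N_pos).
  auto_derive.
  - kernel_side.
  - field. lra.
Qed.

Lemma is_derive_KT_r : is_derive (fun r => KT r t) r (- / 2 * PTT r t / r).
Proof.
  unfold KT, PTT. assert (H := N_pos).
  auto_derive.
  - kernel_side.
  - field. lra.
Qed.

Lemma is_derive_PT_r : is_derive (fun r => PT r t) r (2 * KTT r t / r).
Proof.
  unfold KTT, PT. assert (H := N_pos).
  auto_derive.
  - kernel_side.
  - field. lra.
Qed.

End Kernel_derivatives.

Lemma cos_add_2PI (t : R) : cos (t + 2 * PI) = cos t.
Proof. rewrite cos_plus, cos_2PI, sin_2PI. ring. Qed.

Lemma sin_add_2PI (t : R) : sin (t + 2 * PI) = sin t.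
Proof. rewrite sin_plus, cos_2PI, sin_2PI. ring. Qed.

Lemma is_derive_shift (f : R -> R) (phi t l : R) :
  is_derive f (t - phi) l -> is_derive (fun t => f (t - phi)) t l.
Proof.
  intros H. replace l with (1 * l) by ring.
  apply (is_derive_comp (K := R_AbsRing) (V := R_NormedModule) f (fun t => t - phi)).
  - exact H.
  - auto_derive; trivial.
Qed.

Lemma is_derive_scal_l_R (f : R -> R) (c x l : R) :
  is_derive f x l -> is_derive (fun x => c * f x) x (c * l).
Proof. exact (is_derive_scal f x c l). Qed.

Ltac kernel_denominator_nonzero :=
  cbv beta;
  match goal with |- context [cos (?t - ?phi)] =>
    match goal with Hs : -1 < ?s < 1 |- _ =>
      assert (H := kernel_denominator_pos s (t - phi) Hs); cbn [pow] in H
    end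
  end;
  repeat apply Rmult_integral_contrapositive_currified; lra.

(** By conjugacy the radial component of [P] is the angular derivative of its conjugate, so the same
    few closed formulas serve here and for [K]. *)
Lemma P_polar_harmonic (phi : R) :
  polar_harmonic (fun s t => P s (t - phi)) (fun s t => 2 * KT s (t - phi))
    (fun s t => PT s (t - phi)) (fun s t => PTT s (t - phi)).
Proof.
  split; intros s; try intros t; try intros Hs.
  - apply (is_derive_P_r s (t - phi)); lra.
  - apply (is_derive_shift (P s)), is_derive_P_t. lra.
  - replace (- PTT s (t - phi) / s) with (2 * (- / 2 * PTT s (t - phi) / s)) by (field; lra).
    apply (is_derive_scal_l_R (fun s => KT s (t - phi))), is_derive_KT_r; lra.
  - apply (is_derive_shift (PT s)), is_derive_PT_t. lra.
  - unfold P. continuity_2d. kernel_denominator_nonzero.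
  - unfold KT. continuity_2d. kernel_denominator_nonzero.
  - unfold PT. continuity_2d. kernel_denominator_nonzero.
  - unfold PTT. continuity_2d. kernel_denominator_nonzero.
  - unfold KT, Rdiv. repeat first [rewrite Rmult_0_l | rewrite Rmult_0_r]. reflexivity.
  - unfold P. replace (t + 2 * PI - phi) with (t - phi + 2 * PI) by ring.
    now rewrite cos_add_2PI.
  - unfold PT. replace (t + 2 * PI - phi) with (t - phi + 2 * PI) by ring.
    now rewrite cos_add_2PI, sin_add_2PI.
Qed.

Lemma K_polar_harmonic (phi : R) :
  polar_harmonic (fun s t => K s (t - phi)) (fun s t => - / 2 * PT s (t - phi))
    (fun s t => KT s (t - phi)) (fun s t => KTT s (t - phi)).
Proof.
  split; intros s; try intros t; try intros Hs.
  - apply (is_derive_K_r s (t - phi)); lra.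
  - apply (is_derive_shift (K s)), is_derive_K_t. lra.
  - replace (- KTT s (t - phi) / s) with (- / 2 * (2 * KTT s (t - phi) / s)) by (field; lra).
    apply (is_derive_scal_l_R (fun s => PT s (t - phi))), is_derive_PT_r; lra.
  - apply (is_derive_shift (KT s)), is_derive_KT_t. lra.
  - unfold K. continuity_2d. kernel_denominator_nonzero.
  - unfold PT. continuity_2d. kernel_denominator_nonzero.
  - unfold KT. continuity_2d. kernel_denominator_nonzero.
  - unfold KTT. continuity_2d. kernel_denominator_nonzero.
  - unfold PT, Rdiv. repeat first [rewrite Rmult_0_l | rewrite Rmult_0_r]. reflexivity.
  - unfold K. replace (t + 2 * PI - phi) with (t - phi + 2 * PI) by ring.
    now rewrite cos_add_2PI, sin_add_2PI.
  - unfold KT. replace (t + 2 * PI - phi) with (t - phi + 2 * PI) by ring.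
    now rewrite cos_add_2PI.
Qed.

(** * The Poisson formula *)

Lemma RInt_continuous_plus (f g : R -> R) (a b : R) :
  (forall t, continuous f t) -> (forall t, continuous g t) ->
  RInt (fun t => f t + g t) a b = RInt f a b + RInt g a b.
Proof.
  intros Hf Hg. apply (RInt_plus (V := R_CompleteNormedModule));
    now apply ex_RInt_continuous_on.
Qed.

Lemma RInt_continuous_scal (f : R -> R) (c a b : R) :
  (forall t, continuous f t) ->
  RInt (fun t => c * f t) a b = c * RInt f a b.
Proof.
  intros Hf. apply (RInt_scal (V := R_CompleteNormedModule)).
  now apply ex_RInt_continuous_on.
Qed.

Lemma continuous_left_value (f : R -> R) (x l : R) :
  continuous f x -> filterlim f (at_left x) (locally l) -> f x = l.
Proof.
  intros Hf Hl.
  apply (filterlim_locally_unique (F := at_left x) f).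
  - intros Q HQ. apply (filter_le_within (F := locally x)). exact (Hf Q HQ).
  - exact Hl.
Qed.

(** 1 - cos t = 2 sin(t/2)^2. For 0 <= y <= 2 the Taylor bound gives sin y >= y - y^3/6 >= y/3; with
    y = t/2 this is 1 - cos t >= t^2/18. The crude bound PI <= 4 puts t/2 in the required range. *)
Lemma one_sub_cos_lower (t : R) : - PI <= t <= PI -> t ^ 2 <= 18 * (1 - cos t).
Proof.
  assert (H4 := PI_4). assert (Hp := PI_RGT_0).
  assert (Pos : forall t, 0 <= t <= PI -> t ^ 2 <= 18 * (1 - cos t)).
  { intros s Hs.
    replace (cos s) with (cos (2 * (s / 2))) by (f_equal; field).
    rewrite cos_2a_sin.
    assert (Hy : 0 <= s / 2 <= 2) by lra.
    destruct (pre_sin_bound (s / 2) 0) as [Hlo _]; [lra | lra |].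
    unfold sin_approx, sin_term in Hlo. simpl in Hlo.
    assert (s / 2 / 3 <= sin (s / 2)).
    { apply Rle_trans with (2 := Hlo). set (y := s / 2) in *.
      assert (y * y <= 4) by nra. field_simplify. nra. }
    nra. }
  intros Ht. destruct (Rle_dec 0 t) as [H | H].
  - apply Pos. lra.
  - rewrite <- cos_neg. replace (t ^ 2) with ((- t) ^ 2) by ring. apply Pos. lra.
Qed.

Lemma P_nonneg (a t : R) : -1 < a < 1 -> 0 <= P a t.
Proof.
  intros Ha. unfold P. apply Rlt_le, Rdiv_lt_0_compat; [nra|].
  now apply kernel_denominator_pos.
Qed.

Lemma continuous_P (a t : R) : -1 < a < 1 -> continuous (P a) t.
Proof. intros Ha. eapply is_derive_continuous, is_derive_P_t. exact Ha. Qed.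

(** The denominator is (1 - a)^2 + 2a(1 - cos t), hence at least a t^2/9; and 1 - a^2 <= 2(1 - a).
    The bound is pointwise, so integrating it costs only the length of the interval. *)
Lemma P_second_moment (a t : R) : 0 < a < 1 -> - PI <= t <= PI ->
  P a t * t ^ 2 <= 18 * (1 - a) / a.
Proof.
  intros Ha Ht. unfold P.
  assert (N := kernel_denominator_pos a t ltac:(lra)).
  assert (T := one_sub_cos_lower t Ht). assert (0 <= t ^ 2) by nra.
  apply Rmult_le_reg_r with (a * (a ^ 2 + 1 - 2 * a * cos t)).
  { apply Rmult_lt_0_compat; lra. }
  replace ((1 - a ^ 2) / (a ^ 2 + 1 - 2 * a * cos t) * t ^ 2
           * (a * (a ^ 2 + 1 - 2 * a * cos t))) with ((1 - a ^ 2) * (a * t ^ 2))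
    by (field; lra).
  replace (18 * (1 - a) / a * (a * (a ^ 2 + 1 - 2 * a * cos t)))
    with (18 * (1 - a) * (a ^ 2 + 1 - 2 * a * cos t)) by (field; lra).
  assert (a * t ^ 2 <= 9 * (a ^ 2 + 1 - 2 * a * cos t)) by nra.
  replace ((1 - a ^ 2) * (a * t ^ 2)) with ((1 - a) * ((1 + a) * (a * t ^ 2))) by ring.
  rewrite (Rmult_comm 18), Rmult_assoc. apply Rmult_le_compat_l; [lra|].
  assert (0 <= a * t ^ 2) by nra. nra.
Qed.

(** The radial derivative of [P] is the t-derivative of 2K/r, and [K] vanishes at both endpoints.
    The integral is therefore the one at radius 0, where [P] is 1. *)
Lemma RInt_P (a : R) : 0 <= a < 1 -> RInt (P a) (- PI) PI = 2 * PI.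
Proof.
  intros Ha. assert (Hp := PI_RGT_0).
  assert (H := P_polar_harmonic 0).
  assert (E : forall t, t - 0 = t) by (intros; ring).
  assert (Cont : forall x t, -1 < x < 1 -> continuity_2d_pt P x t).
  { intros x t Hx. apply continuity_2d_pt_ext with (fun x t => P x (t - 0)).
    - intros; now rewrite E.
    - now apply (ph_cont_V _ _ _ _ H). }
  transitivity (RInt (P 0) (- PI) PI).
  - symmetry. apply (null_derivative_eq (fun x => RInt (P x) (- PI) PI)); [lra | |].
    + intros x Hx.
      assert (Z : RInt (fun t => 2 * KT x t / x) (- PI) PI = 0).
      { apply RInt_derivative_periodic with (fun t => 2 / x * K x t).
        - intros t. replace (2 * KT x t / x) with (2 / x * KT x t) by (field; lra).
          apply is_derive_scal_l_R, is_derive_K_t. lra.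
        - intros t. unfold Rdiv. apply (continuous_mult (K := R_AbsRing)).
          + apply (continuous_mult (K := R_AbsRing)); [apply continuous_const|].
            eapply is_derive_continuous, is_derive_KT_t. lra.
          + apply continuous_const.
        - unfold K. rewrite cos_neg, sin_neg, sin_PI. unfold Rdiv. ring. }
      rewrite <- Z. apply (is_derive_RInt_param' P (fun x t => 2 * KT x t / x)).
      * apply locally_open_interval with 0 1; [lra|]. intros y Hy t.
        apply is_derive_P_r; lra.
      * intros t. apply continuity_2d_pt_ext with (fun x t => 2 * KT x (t - 0) / x).
        { intros; now rewrite E. }
        apply continuity_2d_pt_mult.
        { apply (ph_cont_A _ _ _ _ H). lra. }
        apply (continuity_2d_pt_inv (fun x _ => x)); [apply continuity_2d_pt_id1 | lra].
      * apply locally_open_interval with 0 1; [lra|]. intros y Hy t.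
        apply continuous_P; lra.
    + intros x Hx. apply continuous_RInt_param; [lra | |].
      * intros t. apply Cont. lra.
      * apply locally_open_interval with (-1) 1; [lra|]. intros y Hy t.
        apply continuous_P; lra.
  - transitivity (RInt (fun _ => 1) (- PI) PI).
    + apply RInt_ext. intros t _.
      unfold P. rewrite Rmult_0_r, Rmult_0_l, pow_i, Rplus_0_l, !Rminus_0_r by lia.
      apply Rdiv_diag. lra.
    + rewrite RInt_const. change ((PI - - PI) * 1 = 2 * PI). ring.
Qed.

Lemma first_order_remainder (h h1 h2 : R -> R) (phi : R) :
  (forall t, is_derive h t (h1 t)) -> (forall t, is_derive h1 t (h2 t)) ->
  (forall t, continuous h2 t) ->
  exists M, forall t, - PI <= t <= PI ->
    Rabs (h (phi + t) - h phi - h1 phi * t) <= M * t ^ 2.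
Proof.
  intros D1 D2 Ch. assert (Hp := PI_RGT_0).
  destruct (continuity_ab_maj (fun t => Rabs (h2 t)) (phi - PI) (phi + PI))
    as [m [Hm _]]; [lra | |].
  { intros c _. apply continuity_pt_filterlim.
    apply (continuous_comp h2 Rabs); [apply Ch | apply continuous_Rabs]. }
  exists (Rabs (h2 m)). intros t Ht.
  assert (Mvt : forall f df, (forall t, is_derive f t (df t)) -> forall u,
    exists c, Rabs c <= Rabs u /\ f (phi + u) - f phi = df (phi + c) * u).
  { intros f df Hf u.
    destruct (MVT_gen f phi (phi + u) df) as [c [Hc E]].
    - intros x _. apply Hf.
    - intros x _. apply continuity_pt_filterlim. eapply is_derive_continuous, Hf.
    - exists (c - phi). split.
      + unfold Rmin, Rmax in Hc. destruct (Rle_dec phi (phi + u));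
          [rewrite !Rabs_pos_eq | rewrite !Rabs_left1]; lra.
      + rewrite E. f_equal; [f_equal |]; ring. }
  (* The mean value theorem is applied to [h], then to [h1] on the shorter interval ending at [c].
     Since |c| <= |t|, the remainder is at most the maximum of |h2| times t^2. *)
  destruct (Mvt h h1 D1 t) as [c [Hc Ec]].
  destruct (Mvt h1 h2 D2 c) as [b [Hb Eb]].
  replace (h (phi + t) - h phi - h1 phi * t) with (h2 (phi + b) * c * t)
    by (rewrite Ec, <- Eb; ring).
  rewrite !Rabs_mult, <- (pow2_abs t).
  assert (Rabs t <= PI) by (apply Rabs_le; lra).
  assert (Hbm : Rabs (h2 (phi + b)) <= Rabs (h2 m)).
  { apply Hm. assert (Rabs b <= PI) by lra. apply Rabs_le_between in H0. lra. }
  assert (Hp1 := Rabs_pos (h2 (phi + b))). assert (Hp2 := Rabs_pos c).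
  assert (Hp3 := Rabs_pos t).
  replace (Rabs (h2 m) * Rabs t ^ 2) with (Rabs (h2 m) * Rabs t * Rabs t) by ring.
  apply Rmult_le_compat_r; [lra|]. apply Rmult_le_compat; lra.
Qed.

(* By symmetry of [P a] the first order term of [h] integrates to zero, and the
   second moment of [P a] is [O(1 - a)]. *)
Lemma P_approximate_identity (h h1 h2 : R -> R) (phi : R) :
  (forall t, is_derive h t (h1 t)) -> (forall t, is_derive h1 t (h2 t)) ->
  (forall t, continuous h2 t) -> (forall t, h (t + 2 * PI) = h t) ->
  exists M, forall a, 0 < a < 1 ->
    Rabs (RInt (fun t => P a (t - phi) * h t) (- PI) PI - 2 * PI * h phi)
    <= M * ((1 - a) / a).
Proof.
  intros D1 D2 Ch Hper. assert (Hp := PI_RGT_0).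
  destruct (first_order_remainder h h1 h2 phi D1 D2 Ch) as [M HM].
  (* Length of the interval, times the remainder constant, times the second moment constant; [M] is
     not known to be nonnegative, hence [Rabs M]. *)
  exists (2 * PI * (Rabs M * 18)). intros a Ha.
  assert (Ch0 : forall t, continuous h t) by (intros; eapply is_derive_continuous, D1).
  assert (Ch1 : forall t, continuous h1 t) by (intros; eapply is_derive_continuous, D2).
  assert (CP : forall t, continuous (P a) t) by (intros; apply continuous_P; lra).
  assert (Chphi : forall t, continuous (fun t => h (phi + t)) t).
  { intros t. apply (continuous_comp (fun t => phi + t) h); [|apply Ch0].
    apply (continuous_plus (V := R_NormedModule));
      [apply continuous_const | apply continuous_id]. }
  assert (S : RInt (fun t => P a (t - phi) * h t) (- PI) PI
              = RInt (fun t => P a t * h (phi + t)) (- PI) PI).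
  { rewrite (RInt_shift_periodic (fun t => P a (t - phi) * h t)
      (fun t => PT a (t - phi) * h t + P a (t - phi) * h1 t) phi).
    - apply RInt_ext. intros t _. do 2 f_equal. ring.
    - intros t. apply (is_derive_mult_R (fun t => P a (t - phi)) h); [|apply D1].
      apply (is_derive_shift (P a)), is_derive_P_t. lra.
    - intros t. apply (continuous_plus (V := R_NormedModule));
        apply (continuous_mult (K := R_AbsRing)); auto.
      + eapply is_derive_continuous, (is_derive_shift (PT a)), is_derive_PT_t. lra.
      + eapply is_derive_continuous, (is_derive_shift (P a)), is_derive_P_t. lra.
    - intros t. now rewrite (ph_per_V _ _ _ _ (P_polar_harmonic phi)), Hper. }
  pose (rem := fun t => h (phi + t) - h phi - h1 phi * t).
  assert (Crem : forall t, continuous rem t).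
  { intros t. apply (continuous_minus (V := R_NormedModule)).
    - apply (continuous_minus (V := R_NormedModule)); auto. apply continuous_const.
    - apply (continuous_mult (K := R_AbsRing)); [apply continuous_const | apply continuous_id]. }
  assert (Cid : forall t, continuous (fun t => P a t * t) t).
  { intros t. apply (continuous_mult (K := R_AbsRing)); auto. apply continuous_id. }
  assert (CPr : forall t, continuous (fun t => P a t * rem t) t).
  { intros t. apply (continuous_mult (K := R_AbsRing)); auto. }
  assert (Odd : RInt (fun t => P a t * t) (- PI) PI = 0).
  { apply RInt_odd; auto. intros t. unfold P. rewrite cos_neg. ring. }
  assert (E : RInt (fun t => P a t * h (phi + t)) (- PI) PI - 2 * PI * h phi
              = RInt (fun t => P a t * rem t) (- PI) PI).
  { rewrite <- (RInt_P a) by lra.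
    assert (Cc : forall (c : R) (f : R -> R), (forall t, continuous f t) ->
      forall t, continuous (fun t => c * f t) t).
    { intros c f Hf t. apply (continuous_mult (K := R_AbsRing)); auto.
      apply continuous_const. }
    rewrite (RInt_ext (fun t => P a t * h (phi + t))
      (fun t => P a t * rem t + (h phi * P a t + h1 phi * (P a t * t))))
      by (intros t _;
          change (P a t * h (phi + t) = P a t * (h (phi + t) - h phi - h1 phi * t)
            + (h phi * P a t + h1 phi * (P a t * t))); ring).
    rewrite (RInt_continuous_plus (fun t => P a t * rem t)
               (fun t => h phi * P a t + h1 phi * (P a t * t))),
      (RInt_continuous_plus (fun t => h phi * P a t) (fun t => h1 phi * (P a t * t))),
      (RInt_continuous_scal _ (h phi)), (RInt_continuous_scal _ (h1 phi)), Odd; auto.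
    - ring.
    - intros t. apply (continuous_plus (V := R_NormedModule));
        [apply (Cc (h phi) (P a)) | apply (Cc (h1 phi) (fun t => P a t * t))]; auto. }
  rewrite S, E.
  replace (2 * PI * (Rabs M * 18) * ((1 - a) / a))
    with ((PI - - PI) * (Rabs M * (18 * (1 - a) / a))) by (field; lra).
  apply abs_RInt_le_const; [lra | now apply ex_RInt_continuous_on |].
  intros t Ht. rewrite Rabs_mult, (Rabs_pos_eq (P a t)) by (apply P_nonneg; lra).
  assert (H1 := P_nonneg a t ltac:(lra)). assert (H2 := P_second_moment a t Ha Ht).
  assert (H3 := HM t Ht). assert (H4 := Rle_abs M). assert (H5 : 0 <= t ^ 2) by nra.
  assert (H6 := Rabs_pos M).
  apply Rle_trans with (P a t * (Rabs M * t ^ 2)).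
  - apply Rmult_le_compat_l; [exact H1|]. fold (rem t) in H3. nra.
  - replace (P a t * (Rabs M * t ^ 2)) with (Rabs M * (P a t * t ^ 2)) by ring.
    now apply Rmult_le_compat_l.
Qed.

Lemma poisson_formula (V A B C : R -> R -> R) (a b phi : R) :
  polar_harmonic V A B C -> 0 < a < 1 -> 0 < b < 1 ->
  RInt (fun t => P a (t - phi) * V b t) (- PI) PI = 2 * PI * V (a * b) phi.
Proof.
  intros H Ha Hb.
  assert (Hab : 0 < a * b < b) by nra.
  destruct (P_approximate_identity (V (a * b)) (B (a * b)) (C (a * b)) phi) as [M HM].
  - intros t. apply (ph_angular _ _ _ _ H). lra.
  - intros t. apply (ph_angular2 _ _ _ _ H). lra.
  - intros t. apply continuity_2d_pt_section_r, (ph_cont_C _ _ _ _ H). lra.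
  - apply (ph_per_V _ _ _ _ H).
  (* The total product of radii is lowered to [x * (a * b)], so that it can be split again as [x]
     for the kernel and [a * b] for [V]. As x tends to 1, the approximate identity then acts on one
     fixed function V(ab, .), while [F] tends to [F 1]. *)
  - pose (F := fun x => RInt (fun t => P a (t - phi) * V (x * b) t) (- PI) PI).
    transitivity (F 1).
    { unfold F. now rewrite Rmult_1_l. }
    apply continuous_left_value.
    + apply (continuous_RInt_product (fun s t => P s (t - phi)) _ _ _ V A B C
               (P_polar_harmonic phi) H (fun _ => a) (fun x => x * b)).
      * apply continuous_const.
      * apply (continuous_mult (K := R_AbsRing)); [apply continuous_id | apply continuous_const].
      * apply locally_open_interval with 0 (/ b).
        { split; [lra|]. rewrite <- Rinv_1. apply Rinv_lt_contravar; lra. }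
        intros y Hy. assert (b * / b = 1) by (field; lra). nra.
    + apply filterlim_locally. intros eps.
      (* The bound 1/2 gives 1/x <= 2, hence (1 - x)/x <= 2(1 - x); the other entry makes |M| times
         this less than [eps]. *)
      assert (Hd : 0 < Rmin (/ 2) (eps / (2 * (Rabs M + 1)))).
      { assert (HA := Rabs_pos M). apply Rmin_glb_lt; [lra|].
        apply Rdiv_lt_0_compat; [apply cond_pos | lra]. }
      exists (mkposreal _ Hd). intros x Hx Hx1.
      change (Rabs (x - 1) < Rmin (/ 2) (eps / (2 * (Rabs M + 1)))) in Hx.
      assert (HA := Rabs_pos M).
      assert (X1 := Rlt_le_trans _ _ _ Hx (Rmin_l _ _)).
      assert (X2 := Rlt_le_trans _ _ _ Hx (Rmin_r _ _)).
      rewrite Rabs_left in X1, X2 by lra.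
      assert (I : 0 < x < 1) by lra.
      assert (E : F x = RInt (fun t => P x (t - phi) * V (a * b) t) (- PI) PI).
      { unfold F. assert (J : 0 < x * (a * b)) by (apply Rmult_lt_0_compat; lra).
        assert (Hinv := polar_product_invariant (fun s t => P s (t - phi)) _ _ _ V A B C
                       (P_polar_harmonic phi) H (x * (a * b)) a x J).
        cbv beta in Hinv.
        replace (x * b) with (x * (a * b) / a) by (field; lra). rewrite Hinv; [|nra|nra].
        apply RInt_ext. intros t _. do 2 f_equal. field. lra. }
      change (Rabs (F x - 2 * PI * V (a * b) phi) < eps).
      rewrite E. apply Rle_lt_trans with (1 := HM x I).
      apply Rle_lt_trans with (Rabs M * (2 * (1 - x))).
      * assert (0 <= (1 - x) / x <= 2 * (1 - x)).
        { split; [apply Rlt_le, Rdiv_lt_0_compat; lra|].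
          apply Rmult_le_reg_r with x; [lra|].
          replace ((1 - x) / x * x) with (1 - x) by (field; lra). nra. }
        assert (HM' := Rle_abs M). nra.
      * apply Rlt_le_trans with ((eps / (2 * (Rabs M + 1))) * (2 * (Rabs M + 1))).
        { nra. }
        right. field. lra.
Qed.

(** * Harmonic functions in polar coordinates *)

Lemma polar_eq (s t : R) : polar s t = (s * cos t, s * sin t).
Proof. unfold polar, cis, RtoC, Cmult. simpl. f_equal; ring. Qed.

Lemma Cmod_polar (s t : R) : Cmod (polar s t) = Rabs s.
Proof.
  rewrite polar_eq. unfold Cmod. cbn [fst snd].
  replace ((s * cos t) ^ 2 + (s * sin t) ^ 2) with (Rsqr s * (Rsqr (sin t) + Rsqr (cos t)))
    by (unfold Rsqr; ring).
  rewrite sin2_cos2, Rmult_1_r. apply sqrt_Rsqr_abs.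
Qed.

Lemma disk_polar (s t : R) : -1 < s < 1 -> disk (polar s t).
Proof. intros H. unfold disk. rewrite Cmod_polar. apply Rabs_def1; lra. Qed.

Lemma open_disk (z : C) : disk z -> locally z disk.
Proof.
  intros Hz.
  assert (Hc : continuous (fun w : C => Cmod w) z).
  { apply (continuous_comp (fun w : C => fst w ^ 2 + snd w ^ 2) sqrt).
    - apply (continuous_plus (V := R_NormedModule)).
      + apply (continuous_comp (fun w : R * R => fst w) (fun x : R => x ^ 2)).
        * apply continuous_fst.
        * apply continuity_pt_filterlim, derivable_continuous_pt, derivable_pt_pow.
      + apply (continuous_comp (fun w : R * R => snd w) (fun x : R => x ^ 2)).
        * apply continuous_snd.
        * apply continuity_pt_filterlim, derivable_continuous_pt, derivable_pt_pow.
    - apply continuous_sqrt. }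
  exact (Hc _ (open_lt 1 _ Hz)).
Qed.

Section Chain_rule.

Variable v : C -> R.
Hypothesis Hv : C1_in disk v.

(** Partial derivatives alone do not compose with a curve. The total differential does, and it
    yields both the continuity of [v] and the chain rule along circles and rays. *)
Lemma filterdiff_C1_in (x y : R) : disk (x, y) ->
  filterdiff (fun w : R * R => v (fst w, snd w)) (locally (x, y))
    (fun w : R * R => plus (scal (fst w) (dx v (x, y))) (scal (snd w) (dy v (x, y)))).
Proof.
  intros Hz.
  apply (is_derive_filterdiff (fun a b => v (a, b)) x y (fun a b => dx v (a, b))).
  - generalize (open_disk _ Hz). apply filter_imp. intros [a b] Hab.
    apply (Derive_correct (fun x => v (x, b)) a).
    exact (proj1 (Hv (a, b) Hab)).
  - apply (Derive_correct (fun y => v (x, y)) y).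
    exact (proj1 (proj2 (Hv (x, y) Hz))).
  - apply (continuous_ext (dx v)).
    + intros [a b]; reflexivity.
    + exact (proj1 (proj2 (proj2 (Hv (x, y) Hz)))).
Qed.

Lemma continuous_C1_in (z : C) : disk z -> continuous v z.
Proof.
  intros Hz. destruct z as [x y].
  apply (continuous_ext (fun w : R * R => v (fst w, snd w))).
  - intros [a b]; reflexivity.
  - apply (filterdiff_continuous (K := R_AbsRing)
      (U := prod_NormedModule R_AbsRing R_NormedModule R_NormedModule) (V := R_NormedModule)
      (fun w : R * R => v (fst w, snd w))).
    eexists. now apply filterdiff_C1_in.
Qed.

Lemma is_derive_C1_in (X Y : R -> R) (x X' Y' : R) :
  is_derive X x X' -> is_derive Y x Y' -> disk (X x, Y x) ->
  is_derive (fun x => v (X x, Y x)) x (X' * dx v (X x, Y x) + Y' * dy v (X x, Y x)).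
Proof.
  intros HX HY Hz.
  assert (H := @filterdiff_comp'_2 R_AbsRing R_NormedModule R_NormedModule R_NormedModule
    R_NormedModule X Y (fun a b => v (a, b)) x (fun h => scal h X') (fun h => scal h Y')
    (fun a b => plus (scal a (dx v (X x, Y x))) (scal b (dy v (X x, Y x))))
    HX HY (filterdiff_C1_in _ _ Hz)).
  unfold is_derive. eapply filterdiff_ext_lin; [exact H|].
  intros h. unfold plus, scal; simpl. unfold mult; simpl. ring.
Qed.

End Chain_rule.

Lemma continuity_2d_pt_of_continuous (v : C -> R) (x y : R) :
  continuous v (x, y) -> continuity_2d_pt (fun a b => v (a, b)) x y.
Proof.
  intros Hv eps. destruct (proj1 (filterlim_locally _ _) Hv eps) as [d Hd].
  exists d. intros a b Ha Hb. exact (Hd (a, b) (conj Ha Hb)).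
Qed.

Lemma continuity_2d_pt_comp (f X Y : R -> R -> R) (s t : R) :
  continuity_2d_pt f (X s t) (Y s t) ->
  continuity_2d_pt X s t -> continuity_2d_pt Y s t ->
  continuity_2d_pt (fun s t => f (X s t) (Y s t)) s t.
Proof.
  intros Hf HX HY eps. destruct (Hf eps) as [d Hd].
  generalize (locally_2d_and _ _ _ _ (HX d) (HY d)). apply locally_2d_impl.
  apply locally_2d_forall. intros a b [H1 H2]. now apply Hd.
Qed.

Lemma continuity_2d_pt_polar (v : C -> R) (s t : R) :
  continuous v (polar s t) -> continuity_2d_pt (fun s t => v (polar s t)) s t.
Proof.
  rewrite polar_eq. intros Hv.
  apply continuity_2d_pt_ext with (fun s t => v (s * cos t, s * sin t)).
  { intros a b. now rewrite polar_eq. }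
  apply (continuity_2d_pt_comp (fun a b => v (a, b))
           (fun s t => s * cos t) (fun s t => s * sin t)).
  - now apply continuity_2d_pt_of_continuous.
  - continuity_2d.
  - continuity_2d.
Qed.

Section Harmonic_in_polar_coordinates.

Variable u : C -> R.

Definition polar_radial (s t : R) : R :=
  s * cos t * dx u (polar s t) + s * sin t * dy u (polar s t).

Definition polar_angular (s t : R) : R :=
  - s * sin t * dx u (polar s t) + s * cos t * dy u (polar s t).

Definition polar_angular2 (s t : R) : R :=
  - s * cos t * dx u (polar s t) - s * sin t * dy u (polar s t)
  + (s * sin t) * (s * sin t) * dx (dx u) (polar s t)
  - (s * sin t) * (s * cos t) * (dy (dx u) (polar s t) + dx (dy u) (polar s t))
  + (s * cos t) * (s * cos t) * dy (dy u) (polar s t).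

Lemma is_derive_polar_s (v : C -> R) (s t : R) : C1_in disk v -> -1 < s < 1 ->
  is_derive (fun s => v (polar s t)) s
    (cos t * dx v (polar s t) + sin t * dy v (polar s t)).
Proof.
  intros Hv Hs. assert (D := disk_polar s t Hs).
  apply is_derive_ext with (fun s => v (s * cos t, s * sin t)).
  { intros x. now rewrite polar_eq. }
  rewrite polar_eq in *.
  apply (is_derive_C1_in v Hv (fun s => s * cos t) (fun s => s * sin t)); trivial;
    auto_derive; trivial; ring.
Qed.

Lemma is_derive_polar_t (v : C -> R) (s t : R) : C1_in disk v -> -1 < s < 1 ->
  is_derive (fun t => v (polar s t)) t
    (- s * sin t * dx v (polar s t) + s * cos t * dy v (polar s t)).
Proof.
  intros Hv Hs. assert (D := disk_polar s t Hs).
  apply is_derive_ext with (fun t => v (s * cos t, s * sin t)).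
  { intros x. now rewrite polar_eq. }
  rewrite polar_eq in *.
  apply (is_derive_C1_in v Hv (fun t => s * cos t) (fun t => s * sin t)); trivial;
    auto_derive; trivial; ring.
Qed.

Lemma is_derive_plus_R (f g : R -> R) (x df dg : R) :
  is_derive f x df -> is_derive g x dg -> is_derive (fun x => f x + g x) x (df + dg).
Proof. intros Hf Hg. exact (is_derive_plus (V := R_NormedModule) f g x df dg Hf Hg). Qed.

Lemma harmonic_polar : harmonic_in disk u ->
  polar_harmonic (fun s t => u (polar s t)) polar_radial polar_angular polar_angular2.
Proof.
  intros [[C0 [Cx Cy]] Lap].
  assert (Cu := continuous_C1_in u C0).
  assert (Cdx := continuous_C1_in (dx u) Cx).
  assert (Cdy := continuous_C1_in (dy u) Cy).
  split; intros s; try intros t; try intros Hs;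
    try (assert (Hs1 : -1 < s < 1) by lra; assert (Dz := disk_polar s t Hs1)).
  - replace (polar_radial s t / s)
      with (cos t * dx u (polar s t) + sin t * dy u (polar s t))
      by (unfold polar_radial; field; lra).
    now apply is_derive_polar_s.
  - now apply (is_derive_polar_t u).
  (* (s d/ds)^2 u + d^2u/dt^2 equals s^2 times the Laplacian. The mixed partials occur in both terms
     through their sum, with opposite signs, and cancel. *)
  - assert (L := Lap _ Dz). unfold laplacian in L.
    unfold polar_radial.
    evar_last.
    { apply (is_derive_plus_R (fun s => s * cos t * dx u (polar s t))
               (fun s => s * sin t * dy u (polar s t)));
      [ apply (is_derive_mult_R (fun s => s * cos t) (fun s => dx u (polar s t)) s (cos t))
      | apply (is_derive_mult_R (fun s => s * sin t) (fun s => dy u (polar s t)) s (sin t)) ];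
      try (now apply is_derive_polar_s); auto_derive; trivial; ring. }
    assert (E : dy (dy u) (polar s t) = - dx (dx u) (polar s t)) by lra.
    assert (S := sin_sqr t).
    apply Rmult_eq_reg_r with s; [|lra]. unfold Rdiv.
    rewrite (Rmult_assoc _ (/ s) s), Rinv_l by lra.
    unfold polar_angular2. rewrite E.
    ring_simplify. replace (sin t ^ 2) with (1 - cos t ^ 2) by (rewrite <- S; ring). ring.
  - unfold polar_angular.
    evar_last.
    { apply (is_derive_plus_R (fun t => - s * sin t * dx u (polar s t))
               (fun t => s * cos t * dy u (polar s t)));
      [ apply (is_derive_mult_R (fun t => - s * sin t) (fun t => dx u (polar s t))
                 t (- s * cos t))
      | apply (is_derive_mult_R (fun t => s * cos t) (fun t => dy u (polar s t))
                 t (- s * sin t)) ];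
      try (now apply is_derive_polar_t); auto_derive; trivial; ring. }
    unfold polar_angular2. ring.
  - apply (continuity_2d_pt_polar u). now apply Cu.
  - unfold polar_radial. continuity_2d;
      [apply (continuity_2d_pt_polar (dx u)) | apply (continuity_2d_pt_polar (dy u))]; auto.
  - unfold polar_angular. continuity_2d;
      [apply (continuity_2d_pt_polar (dx u)) | apply (continuity_2d_pt_polar (dy u))]; auto.
  - unfold polar_angular2.
    destruct (Cx _ Dz) as [_ [_ [? ?]]]. destruct (Cy _ Dz) as [_ [_ [? ?]]].
    continuity_2d;
      first [ now apply (continuity_2d_pt_polar (dx u)), Cdx
            | now apply (continuity_2d_pt_polar (dy u)), Cdy
            | now apply (continuity_2d_pt_polar (dx (dx u)))
            | now apply (continuity_2d_pt_polar (dx (dy u)))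
            | now apply (continuity_2d_pt_polar (dy (dx u)))
            | now apply (continuity_2d_pt_polar (dy (dy u))) ].
  - unfold polar_radial. ring.
  - now rewrite !polar_eq, cos_add_2PI, sin_add_2PI.
  - unfold polar_angular. now rewrite !polar_eq, cos_add_2PI, sin_add_2PI.
Qed.

(** The gradient in the rotating orthonormal frame. Both polar components carry a factor [s], which
    accounts for the two factors 1/r of the result. *)
Lemma grad_polar (r phi : R) : r <> 0 ->
  grad u (polar r phi)
  = (RtoC (1 / r * polar_radial r phi) * cis phi
     + RtoC (1 / r * polar_angular r phi) * cis (phi + PI / 2))%C.
Proof.
  intros Hr. unfold grad, cis, RtoC, Cplus, Cmult, polar_radial, polar_angular.
  rewrite cos_plus, sin_plus, cos_PI2, sin_PI2. cbn [fst snd].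
  assert (S := sin_sqr phi).
  set (p := dx u (polar r phi)). set (q := dy u (polar r phi)).
  f_equal.
  - transitivity (p * (cos phi ^ 2 + sin phi * sin phi)).
    + rewrite S; ring.
    + field. exact Hr.
  - transitivity (q * (cos phi ^ 2 + sin phi * sin phi)).
    + rewrite S; ring.
    + field. exact Hr.
Qed.

End Harmonic_in_polar_coordinates.

(** * Passage to the boundary *)

Section Differentiated_poisson_formula.

Variables V A B C : R -> R -> R.
Hypothesis H : polar_harmonic V A B C.
Variables a b phi : R.
Hypothesis Ha : 0 < a < 1.
Hypothesis Hb : 0 < b < 1.

(** With [b] fixed, a d/da of V(ab, phi) is A(ab, phi), while under the integral it falls on the
    kernel alone and turns [P] into [2 * KT]. *)
Lemma poisson_radial :
  RInt (fun t => 2 * KT a (t - phi) * V b t) (- PI) PI = 2 * PI * A (a * b) phi.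
Proof.
  assert (HP := P_polar_harmonic phi).
  assert (Cb : forall t, continuity_2d_pt (fun _ t => V b t) a t).
  { intros t. apply (continuity_2d_pt_comp_l V (fun _ => b)).
    - apply continuous_const.
    - apply (ph_cont_V _ _ _ _ H). lra. }
  assert (D1 : is_derive (fun x => 2 * PI * V (x * b) phi) a
                 (2 * PI * (b * (A (a * b) phi / (a * b))))).
  { apply is_derive_scal_l_R, (is_derive_comp_l V (fun x => x * b)).
    - apply (ph_radial _ _ _ _ H). nra.
    - auto_derive; trivial. ring. }
  assert (D2 : is_derive (fun x => 2 * PI * V (x * b) phi) a
                 (RInt (fun t => / a * (2 * KT a (t - phi) * V b t)) (- PI) PI)).
  { apply is_derive_ext_loc
      with (fun x => RInt (fun t => P x (t - phi) * V b t) (- PI) PI).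
    - apply locally_open_interval with 0 1; [lra|]. intros x Hx.
      now apply (poisson_formula V A B C).
    - apply (is_derive_RInt_param' (fun x t => P x (t - phi) * V b t)
               (fun x t => / x * (2 * KT x (t - phi) * V b t))).
      + apply locally_open_interval with 0 1; [lra|]. intros x Hx t.
        replace (/ x * (2 * KT x (t - phi) * V b t))
          with (2 * KT x (t - phi) / x * V b t + P x (t - phi) * 0) by (field; lra).
        apply (is_derive_mult_R (fun x => P x (t - phi)) (fun _ => V b t)).
        * now apply (ph_radial _ _ _ _ HP).
        * apply (is_derive_const (V := R_NormedModule)).
      + intros t. apply continuity_2d_pt_mult.
        { apply (continuity_2d_pt_inv (fun x _ => x)); [apply continuity_2d_pt_id1 | lra]. }
        apply continuity_2d_pt_mult; [|apply Cb].
        apply (ph_cont_A _ _ _ _ HP). lra.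
      + apply locally_open_interval with 0 1; [lra|]. intros x Hx t.
        apply (continuous_mult (K := R_AbsRing)).
        * apply (continuity_2d_pt_section_r (fun s t => P s (t - phi))),
            (ph_cont_V _ _ _ _ HP). lra.
        * apply continuity_2d_pt_section_r, (ph_cont_V _ _ _ _ H). lra. }
  assert (E := eq_trans (eq_sym (is_derive_unique _ _ _ D1)) (is_derive_unique _ _ _ D2)).
  rewrite RInt_continuous_scal in E.
  - apply Rmult_eq_reg_l with (/ a); [|apply Rinv_neq_0_compat; lra].
    rewrite <- E. field. lra.
  - intros t. apply (continuous_mult (K := R_AbsRing)).
    + apply (continuity_2d_pt_section_r (fun s t => 2 * KT s (t - phi))),
        (ph_cont_A _ _ _ _ HP). lra.
    + apply continuity_2d_pt_section_r, (ph_cont_V _ _ _ _ H). lra.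
Qed.

(** The sign on the right records that the kernel sees phi through t - phi. *)
Lemma poisson_angular :
  RInt (fun t => PT a (t - phi) * V b t) (- PI) PI = - (2 * PI * B (a * b) phi).
Proof.
  assert (HP := P_polar_harmonic phi).
  assert (D1 : is_derive (fun x => 2 * PI * V (a * b) x) phi (2 * PI * B (a * b) phi)).
  { apply (is_derive_scal_l_R (V (a * b))), (ph_angular _ _ _ _ H). nra. }
  assert (D2 : is_derive (fun x => 2 * PI * V (a * b) x) phi
                 (RInt (fun t => - 1 * (PT a (t - phi) * V b t)) (- PI) PI)).
  { apply is_derive_ext
      with (fun x => RInt (fun t => P a (t - x) * V b t) (- PI) PI).
    { intros x. now apply (poisson_formula V A B C). }
    apply (is_derive_RInt_param' (fun x t => P a (t - x) * V b t)
               (fun x t => - 1 * (PT a (t - x) * V b t))).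
    - apply filter_forall. intros x t.
      replace (- 1 * (PT a (t - x) * V b t))
        with (- 1 * PT a (t - x) * V b t + P a (t - x) * 0) by ring.
      apply (is_derive_mult_R (fun x => P a (t - x)) (fun _ => V b t)).
      + apply (is_derive_comp (K := R_AbsRing) (V := R_NormedModule) (P a) (fun x => t - x)).
        * apply is_derive_P_t. lra.
        * auto_derive; trivial; ring.
      + apply (is_derive_const (V := R_NormedModule)).
    - intros t. apply continuity_2d_pt_mult; [apply continuity_2d_pt_const|].
      apply continuity_2d_pt_mult.
      + apply (continuity_1d_2d_pt_comp (PT a) (fun x t => t - x)).
        * apply continuity_pt_filterlim.
          eapply is_derive_continuous, is_derive_PT_t. lra.
        * apply continuity_2d_pt_minus; [apply continuity_2d_pt_id2 | apply continuity_2d_pt_id1].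
      + apply (continuity_2d_pt_comp_l V (fun _ => b)).
        * apply continuous_const.
        * apply (ph_cont_V _ _ _ _ H). lra.
    - apply filter_forall. intros x t. apply (continuous_mult (K := R_AbsRing)).
      + eapply is_derive_continuous, (is_derive_shift (P a)), is_derive_P_t. lra.
      + apply continuity_2d_pt_section_r, (ph_cont_V _ _ _ _ H). lra. }
  assert (E := eq_trans (eq_sym (is_derive_unique _ _ _ D1)) (is_derive_unique _ _ _ D2)).
  rewrite RInt_continuous_scal in E; [lra|].
  intros t. apply (continuous_mult (K := R_AbsRing)).
  - eapply is_derive_continuous, (is_derive_shift (PT a)), is_derive_PT_t. lra.
  - apply continuity_2d_pt_section_r, (ph_cont_V _ _ _ _ H). lra.
Qed.

End Differentiated_poisson_formula.

Lemma polar_green_symmetric (V1 A1 B1 C1 V2 A2 B2 C2 : R -> R -> R) (a b : R) :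
  polar_harmonic V1 A1 B1 C1 -> polar_harmonic V2 A2 B2 C2 ->
  0 < a < 1 -> 0 < b < 1 ->
  RInt (fun t => A1 a t * V2 b t) (- PI) PI = RInt (fun t => V1 a t * A2 b t) (- PI) PI.
Proof.
  intros H1 H2 Ha Hb.
  assert (C1' : forall t, continuous (fun t => A1 a t * V2 b t) t).
  { intros t. apply (continuous_mult (K := R_AbsRing)); apply continuity_2d_pt_section_r;
      [apply (ph_cont_A _ _ _ _ H1) | apply (ph_cont_V _ _ _ _ H2)]; lra. }
  assert (C2' : forall t, continuous (fun t => V1 a t * A2 b t) t).
  { intros t. apply (continuous_mult (K := R_AbsRing)); apply continuity_2d_pt_section_r;
      [apply (ph_cont_V _ _ _ _ H1) | apply (ph_cont_A _ _ _ _ H2)]; lra. }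
  assert (E := polar_green _ _ _ _ _ _ _ _ H1 H2 a b Ha Hb).
  assert (M := RInt_minus (V := R_CompleteNormedModule) _ _ _ _
    (ex_RInt_continuous_on _ (- PI) PI C1') (ex_RInt_continuous_on _ (- PI) PI C2')).
  apply Rminus_diag_uniq. rewrite <- E. symmetry. exact M.
Qed.

Lemma continuous_Rmin_1 (b : R) : continuous (fun b => Rmin b 1) b.
Proof.
  apply filterlim_locally. intros eps. exists eps. intros y Hy.
  change (Rabs (Rmin y 1 - Rmin b 1) < eps). change (Rabs (y - b) < eps) in Hy.
  apply Rle_lt_trans with (2 := Hy).
  unfold Rmin. destruct (Rle_dec y 1), (Rle_dec b 1);
    unfold Rabs; repeat destruct Rcase_abs; lra.
Qed.

(** Nothing is known about [f] outside the closed disk, whereas continuity of parameter integrals is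
    two-sided. Truncating the radius at 1 extends [f] continuously across the circle, and -1 < b
    keeps the truncated radius in the closed disk. *)
Lemma continuity_2d_pt_closed_disk (f : C -> R) (b t : R) :
  continuous_on closed_disk f -> -1 < b ->
  continuity_2d_pt (fun b t => f (polar (Rmin b 1) t)) b t.
Proof.
  intros Hf Hb.
  assert (CD : forall x s, -1 < x -> closed_disk (polar (Rmin x 1) s)).
  { intros x s Hx. unfold closed_disk. rewrite Cmod_polar. apply Rabs_le.
    split; [apply Rmin_glb; lra | apply Rmin_r]. }
  assert (Cp : forall h, continuity h ->
    continuity_2d_pt (fun b t => Rmin b 1 * h t) b t).
  { intros h Hh. apply continuity_2d_pt_mult.
    - apply (continuity_1d_2d_pt_comp (fun b => Rmin b 1) (fun b _ => b)).
      + apply continuity_pt_filterlim, continuous_Rmin_1.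
      + apply continuity_2d_pt_id1.
    - apply (continuity_1d_2d_pt_comp h (fun _ t => t)).
      + apply Hh.
      + apply continuity_2d_pt_id2. }
  intros eps.
  destruct (proj1 (filterlim_locally _ _) (Hf _ (CD b t Hb)) eps) as [d Hd].
  assert (L0 : locally_2d (fun x _ => -1 < x) b t).
  { assert (Hb' : 0 < b + 1) by lra. exists (mkposreal _ Hb'). simpl.
    intros x _ Hx _. apply Rabs_def2 in Hx. lra. }
  generalize (locally_2d_and _ _ _ _ L0
    (locally_2d_and _ _ _ _ (Cp cos continuity_cos d) (Cp sin continuity_sin d))).
  apply locally_2d_impl, locally_2d_forall. intros x s [Hx [K1 K2]].
  apply (Hd (polar (Rmin x 1) s)); [|now apply CD].
  rewrite !polar_eq. exact (conj K1 K2).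
Qed.

(** After truncation the integral is continuous in [b] at 1, and it has the constant value [c] for r
    < b < 1, so [c] is also its value at 1. There the kernel radius is [r] and [f] is evaluated on
    the circle. *)
Lemma boundary_integral (k : R -> R -> R) (f : C -> R) (r c : R) :
  0 < r < 1 -> continuous_on closed_disk f ->
  (forall s t, -1 < s < 1 -> continuity_2d_pt k s t) ->
  (forall b, r < b < 1 -> RInt (fun t => k (r / b) t * f (polar b t)) (- PI) PI = c) ->
  RInt (fun t => k r t * f (cis t)) (- PI) PI = c.
Proof.
  intros Hr Hf Hk Hc. assert (Hp := PI_RGT_0).
  assert (Q : forall b, r < b -> -1 < r / Rmin b 1 < 1).
  { intros b Hb. assert (M : r < Rmin b 1) by (apply Rmin_glb_lt; lra).
    assert (0 < r / Rmin b 1) by (apply Rdiv_lt_0_compat; lra).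
    split; [lra|]. apply Rmult_lt_reg_r with (Rmin b 1); [lra|].
    unfold Rdiv. rewrite Rmult_assoc, Rinv_l; lra. }
  pose (F := fun b t => k (r / Rmin b 1) t * f (polar (Rmin b 1) t)).
  assert (CF : forall b t, r < b -> continuity_2d_pt F b t).
  { intros b t Hb. apply continuity_2d_pt_mult.
    - apply (continuity_2d_pt_comp_l k (fun b => r / Rmin b 1)).
      + apply (continuous_mult (K := R_AbsRing)); [apply continuous_const|].
        apply continuous_comp; [apply continuous_Rmin_1|].
        apply continuous_Rinv. apply Rgt_not_eq.
        assert (M : r < Rmin b 1) by (apply Rmin_glb_lt; lra). lra.
      + apply Hk. now apply Q.
    - apply continuity_2d_pt_closed_disk; [exact Hf | lra]. }
  transitivity (RInt (F 1) (- PI) PI).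
  { apply RInt_ext. intros t _. unfold F. rewrite Rmin_left by lra. unfold Rdiv.
    rewrite Rinv_1, Rmult_1_r. unfold polar. f_equal. f_equal.
    now rewrite Cmult_1_l. }
  apply (continuous_left_value (fun b => RInt (F b) (- PI) PI)).
  - apply continuous_RInt_param; [lra | |].
    + intros t. apply CF. lra.
    + apply locally_open_interval with r 2; [lra|]. intros b Hb t.
      apply continuity_2d_pt_section_r, CF. lra.
  - apply filterlim_ext_loc with (fun _ => c); [|apply filterlim_const].
    assert (L : locally 1 (fun b => r < b)).
    { apply locally_open_interval with r 2; [lra|]. intros; lra. }
    unfold at_left, within. revert L. apply filter_imp. intros b Hb Hb1. symmetry.
    rewrite <- (Hc b) by lra. apply RInt_ext. intros t _. unfold F.
    now rewrite Rmin_left by lra.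
Qed.

(** s dw/ds is the scalar product of z with the gradient; written with [G], it has a continuous
    extension to the circle. *)
Lemma polar_radial_closed_disk (w : C -> R) (G : C -> C) (b t : R) :
  (forall z, disk z -> G z = grad w z) -> -1 < b < 1 ->
  polar_radial w b t
  = Re (polar b t) * fst (G (polar b t)) + Im (polar b t) * snd (G (polar b t)).
Proof.
  intros HG Hb. rewrite HG by now apply disk_polar.
  unfold polar_radial, grad. cbn [fst snd]. now rewrite !polar_eq.
Qed.

Lemma continuous_on_radial (G : C -> C) :
  continuous_on closed_disk G ->
  continuous_on closed_disk (fun z => Re z * fst (G z) + Im z * snd (G z)).
Proof.
  intros HG z Hz.
  assert (H1 : filterlim (fun z : C => fst (G z)) (within closed_disk (locally z))
                 (locally (fst (G z)))).
  { eapply filterlim_comp; [exact (HG z Hz)|].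
    apply (continuous_fst (U := R_UniformSpace) (V := R_UniformSpace)). }
  assert (H2 : filterlim (fun z : C => snd (G z)) (within closed_disk (locally z))
                 (locally (snd (G z)))).
  { eapply filterlim_comp; [exact (HG z Hz)|].
    apply (continuous_snd (U := R_UniformSpace) (V := R_UniformSpace)). }
  assert (H3 : filterlim (fun z : C => Re z) (within closed_disk (locally z))
                 (locally (Re z))).
  { apply (filterlim_filter_le_1 (F := locally z)); [apply filter_le_within|].
    apply (continuous_fst (U := R_UniformSpace) (V := R_UniformSpace)). }
  assert (H4 : filterlim (fun z : C => Im z) (within closed_disk (locally z))
                 (locally (Im z))).
  { apply (filterlim_filter_le_1 (F := locally z)); [apply filter_le_within|].
    apply (continuous_snd (U := R_UniformSpace) (V := R_UniformSpace)). }
  apply (filterlim_comp_2 (G := locally (Re z * fst (G z)))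
           (H := locally (Im z * snd (G z)))
           (fun z : C => Re z * fst (G z)) (fun z : C => Im z * snd (G z)) Rplus).
  - eapply (filterlim_comp_2 (fun z : C => Re z) (fun z : C => fst (G z)) Rmult);
      [exact H3 | exact H1 | apply (filterlim_mult (K := R_AbsRing))].
  - eapply (filterlim_comp_2 (fun z : C => Im z) (fun z : C => snd (G z)) Rmult);
      [exact H4 | exact H2 | apply (filterlim_mult (K := R_AbsRing))].
  - apply (filterlim_plus (V := R_NormedModule)).
Qed.

(** By the mean value theorem on a radius, the difference quotient defining the normal derivative is
    a radial derivative at an intermediate point, which tends to the radial component of [G].
    Uniqueness of limits identifies it with [l]. *)
Lemma normal_derivative_radial (w : C -> R) (G : C -> C) (t l : R) :
  continuous_on closed_disk w -> C1_in disk w ->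
  continuous_on closed_disk G -> (forall z, disk z -> G z = grad w z) ->
  is_normal_derivative w (cis t) l ->
  Re (cis t) * fst (G (cis t)) + Im (cis t) * snd (G (cis t)) = l.
Proof.
  intros Cw C1w CG HG Hl.
  pose (f := fun z => Re z * fst (G z) + Im z * snd (G z)).
  (* Inside the disk [f] is b dw/db, so [m] is dw/db itself, continued past b = 1 by truncation. *)
  pose (m := fun b => / b * f (polar (Rmin b 1) t)).
  assert (Ep : polar 1 t = cis t) by (unfold polar; apply Cmult_1_l).
  assert (Cm : continuous m 1).
  { apply (continuous_mult (K := R_AbsRing)).
    - apply continuous_Rinv. lra.
    - apply (continuity_2d_pt_section_l (fun b t => f (polar (Rmin b 1) t))).
      apply continuity_2d_pt_closed_disk; [now apply continuous_on_radial | lra]. }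
  assert (Em : m 1 = f (cis t)).
  { unfold m. now rewrite Rmin_left, Rinv_1, Rmult_1_l, Ep by lra. }
  change (f (cis t) = l). rewrite <- Em.
  apply (filterlim_locally_unique (F := at_left 0)
    (fun x => (w (cis t + RtoC x * cis t)%C - w (cis t)) / x)); [|exact Hl].
  apply filterlim_locally. intros eps.
  destruct (proj1 (filterlim_locally _ _) Cm eps) as [d Hd].
  (* The bound 1/2 keeps the whole segment of radii away from 0. *)
  assert (Hd2 : 0 < Rmin d (/ 2)) by (apply Rmin_glb_lt; [apply cond_pos | lra]).
  exists (mkposreal _ Hd2). intros x Hx Hx0.
  change (Rabs (x - 0) < Rmin d (/ 2)) in Hx. rewrite Rminus_0_r, Rabs_left in Hx by lra.
  assert (X1 := Rlt_le_trans _ _ _ Hx (Rmin_l _ _)).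
  assert (X2 := Rlt_le_trans _ _ _ Hx (Rmin_r _ _)).
  destruct (MVT_gen (fun b => w (polar (Rmin b 1) t)) (1 + x) 1 m) as [c [Hc E]].
  - rewrite Rmin_left, Rmax_right by lra. intros b Hb.
    apply is_derive_ext_loc with (fun b => w (polar b t)).
    { apply locally_open_interval with 0 1; [lra|]. intros y Hy.
      now rewrite Rmin_left by lra. }
    replace (m b) with (cos t * dx w (polar b t) + sin t * dy w (polar b t)).
    { apply is_derive_polar_s; [exact C1w | lra]. }
    unfold m, f. rewrite Rmin_left by lra.
    rewrite <- (polar_radial_closed_disk w G b t HG) by lra.
    unfold polar_radial. field. lra.
  - rewrite Rmin_left, Rmax_right by lra. intros b Hb.
    apply continuity_pt_filterlim.
    apply (continuity_2d_pt_section_l (fun b t => w (polar (Rmin b 1) t))).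
    apply continuity_2d_pt_closed_disk; [exact Cw | lra].
  - rewrite Rmin_left, Rmax_right in Hc by lra.
    rewrite (Rmin_left 1 1), (Rmin_left (1 + x) 1), Ep in E by lra.
    replace (cis t + RtoC x * cis t)%C with (polar (1 + x) t).
    + replace ((w (polar (1 + x) t) - w (cis t)) / x) with (m c).
      * apply Hd. change (Rabs (c - 1) < d). apply Rabs_def1; lra.
      * replace (w (polar (1 + x) t) - w (cis t))
          with (- (w (cis t) - w (polar (1 + x) t))) by ring.
        rewrite E. field. lra.
    + unfold polar. rewrite RtoC_plus. ring.
Qed.

Lemma continuous_holder (f : R -> R) (alpha M : R) :
  0 < alpha ->
  (forall s t, s <> t -> Rabs (f s - f t) <= M * Rpower (Rabs (s - t)) alpha) ->
  forall t, continuous f t.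
Proof.
  intros Ha Hf t. apply filterlim_locally. intros eps.
  assert (He := cond_pos eps). assert (HM := Rabs_pos M).
  assert (Hq : 0 < eps / (Rabs M + 1)) by (apply Rdiv_lt_0_compat; lra).
  (* This is (eps / (|M| + 1)) to the power 1/alpha; [Rabs M + 1] covers a zero or negative [M]. *)
  exists (mkposreal _ (exp_pos (/ alpha * ln (eps / (Rabs M + 1))))).
  intros s Hs. change (Rabs (s - t) < exp (/ alpha * ln (eps / (Rabs M + 1)))) in Hs.
  change (Rabs (f s - f t) < eps).
  destruct (Req_dec s t) as [-> | Hst].
  { now rewrite Rminus_diag, Rabs_R0. }
  apply Rle_lt_trans with (1 := Hf s t Hst).
  assert (Hpos : 0 < Rabs (s - t)) by (apply Rabs_pos_lt; lra).
  assert (HR : Rpower (Rabs (s - t)) alpha < eps / (Rabs M + 1)).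
  { unfold Rpower. rewrite <- (exp_ln (eps / (Rabs M + 1))) by exact Hq.
    apply exp_increasing.
    apply Rlt_le_trans with (alpha * (/ alpha * ln (eps / (Rabs M + 1)))).
    - apply Rmult_lt_compat_l; [exact Ha|].
      rewrite <- (ln_exp (/ alpha * _)). now apply ln_increasing.
    - right. field. lra. }
  assert (HR0 : 0 < Rpower (Rabs (s - t)) alpha) by apply exp_pos.
  apply Rle_lt_trans with (Rabs M * Rpower (Rabs (s - t)) alpha).
  - apply Rmult_le_compat_r; [lra | apply Rle_abs].
  - apply Rlt_le_trans with ((Rabs M + 1) * (eps / (Rabs M + 1))).
    + nra.
    + right. field. lra.
Qed.

Lemma dilation_radius (r b : R) : 0 < r < 1 -> r < b < 1 -> 0 < r / b < 1 /\ r / b * b = r.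
Proof.
  intros Hr Hb. assert (E : r / b * b = r) by (field; lra).
  split; [split|exact E].
  - apply Rdiv_lt_0_compat; lra.
  - apply Rmult_lt_reg_r with b; lra.
Qed.

Section Kernel_convolutions.

Variables (r phi : R) (h dh : R -> R).
Hypothesis Hr : 0 < r < 1.
Hypothesis Hh : forall t, is_derive h t (dh t).
Hypothesis Hdh : forall t, continuous dh t.
Hypothesis Hper : forall t, h (t + 2 * PI) = h t.

(** The boundary terms at -PI and PI agree because the shifted kernel and [h] both have period 2
    PI. *)
Lemma conv_by_parts (k dk : R -> R) :
  (forall t, is_derive k t (dk t)) -> (forall t, continuous dk t) ->
  (forall t, k (t + 2 * PI) = k t) ->
  conv k dh phi = - RInt (fun t => dk (t - phi) * h t) (- PI) PI.
Proof.
  intros Hk Hdk Hkp.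
  apply (RInt_by_parts_periodic (fun t => k (t - phi)) h (fun t => dk (t - phi)) dh);
    trivial.
  - intros t. now apply is_derive_shift.
  - intros t. apply (continuous_comp (fun t => t - phi) dk); [|apply Hdk].
    apply (continuous_minus (V := R_NormedModule));
      [apply continuous_id | apply continuous_const].
  - rewrite <- (Hper (- PI)), <- (Hkp (- PI - phi)). f_equal; f_equal; ring.
Qed.

End Kernel_convolutions.

Theorem theorem1p3 (alpha : R) (g : R -> R)
    (Halpha : 0 < alpha < 1) (Hg : C1alpha_circle alpha g) :
  (forall u : C -> R, dirichlet_solution g u ->
     forall r phi : R, 0 < r < 1 ->
       grad u (polar r phi) =
         (- RtoC (1 / r * (1 / PI * conv (K r) (Derive g) phi)) * cis phi
          + RtoC (1 / r * (1 / (2 * PI) * conv (P r) (Derive g) phi))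
              * cis (phi + PI / 2))%C)
  /\
  (RInt g (- PI) PI = 0 ->
   forall w : C -> R, neumann_solution g w ->
     forall r phi : R, 0 < r < 1 ->
       grad w (polar r phi) =
         (RtoC (1 / r * (1 / (2 * PI) * conv (P r) g phi)) * cis phi
          + RtoC (1 / r * (1 / PI * conv (K r) g phi))
              * cis (phi + PI / 2))%C).
Proof.
  assert (Hp := PI_RGT_0).
  split.
  - destruct Hg as [Hper [Hdg [M HM]]].
    (* Continuity of g' makes the integration by parts against the kernels legitimate. *)
    assert (Cdg := continuous_holder (Derive g) alpha M (proj1 Halpha) HM).
    assert (Dg : forall t, is_derive g t (Derive g t))
      by (intros; apply Derive_correct, Hdg).
    intros u [Hu [Cu Bu]] r phi Hr.
    assert (Pu := harmonic_polar u Hu).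
    assert (HP := P_polar_harmonic phi).
    rewrite (grad_polar u r phi) by lra. rewrite <- RtoC_opp.
    do 3 f_equal; f_equal.
    + assert (E : RInt (fun t => 2 * KT r (t - phi) * u (cis t)) (- PI) PI
                  = 2 * PI * polar_radial u r phi).
      { apply (boundary_integral (fun s t => 2 * KT s (t - phi)) u r); trivial.
        - intros s t Hs. now apply (ph_cont_A _ _ _ _ HP).
        - intros b Hb. destruct (dilation_radius r b Hr Hb) as [Hrb E].
          replace (polar_radial u r phi) with (polar_radial u (r / b * b) phi) by now rewrite E.
          apply (poisson_radial _ _ _ _ Pu); lra. }
      rewrite (RInt_ext _ (fun t => 2 * (KT r (t - phi) * g t))) in E
        by (intros t _; rewrite Bu; apply Rmult_assoc).
      rewrite RInt_continuous_scal in E.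
      (* Here the integration by parts is the only source of a sign, hence the minus in the radial
         component. *)
      * rewrite (conv_by_parts phi g (Derive g) Dg Cdg Hper (K r) (KT r)).
        -- apply Rmult_eq_reg_l with (2 * PI * r); [|apply Rmult_integral_contrapositive_currified; lra].
           transitivity (2 * PI * polar_radial u r phi); [field; lra|].
           rewrite <- E. field. lra.
        -- intros t. apply is_derive_K_t. lra.
        -- intros t. eapply is_derive_continuous, is_derive_KT_t. lra.
        -- intros t. unfold K. now rewrite cos_add_2PI, sin_add_2PI.
      * intros t. apply (continuous_mult (K := R_AbsRing)).
        -- eapply is_derive_continuous, (is_derive_shift (KT r)), is_derive_KT_t. lra.
        -- eapply is_derive_continuous, Dg.
    + assert (E : RInt (fun t => PT r (t - phi) * u (cis t)) (- PI) PI
                  = - (2 * PI * polar_angular u r phi)).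
      { apply (boundary_integral (fun s t => PT s (t - phi)) u r); trivial.
        - intros s t Hs. now apply (ph_cont_B _ _ _ _ HP).
        - intros b Hb. destruct (dilation_radius r b Hr Hb) as [Hrb E].
          replace (polar_angular u r phi) with (polar_angular u (r / b * b) phi) by now rewrite E.
          apply (poisson_angular _ _ _ _ Pu); lra. }
      rewrite (RInt_ext _ (fun t => PT r (t - phi) * g t)) in E
        by (intros t _; now rewrite Bu).
      (* The sign from integrating by parts cancels the one in [poisson_angular]. *)
      rewrite (conv_by_parts phi g (Derive g) Dg Cdg Hper (P r) (PT r)).
      * rewrite E. field. lra.
      * intros t. apply is_derive_P_t. lra.
      * intros t. eapply is_derive_continuous, is_derive_PT_t. lra.
      * intros t. unfold P. now rewrite cos_add_2PI.
  - intros _ w [Hw [[Cw [C1w [G [CG HG]]]] [Nw _]]] r phi Hr.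
    assert (Pw := harmonic_polar w Hw).
    (* [f] is s dw/ds inside the disk and [g] on the circle: the function to which the boundary
       limit is applied in place of [w]. *)
    pose (f := fun z => Re z * fst (G z) + Im z * snd (G z)).
    assert (Cf : continuous_on closed_disk f) by now apply continuous_on_radial.
    assert (Bf : forall t, f (cis t) = g t).
    { intros t. now apply (normal_derivative_radial w G). }
    assert (Af : forall b t, -1 < b < 1 -> f (polar b t) = polar_radial w b t).
    { intros b t Hb. symmetry. now apply (polar_radial_closed_disk w G). }
    assert (HP := P_polar_harmonic phi). assert (HK := K_polar_harmonic phi).
    rewrite (grad_polar w r phi) by lra.
    do 3 f_equal; f_equal.
    + assert (E : RInt (fun t => P r (t - phi) * f (cis t)) (- PI) PI
                  = 2 * PI * polar_radial w r phi).
      { apply (boundary_integral (fun s t => P s (t - phi)) f r); trivial.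
        - intros s t Hs. now apply (ph_cont_V _ _ _ _ HP).
        - intros b Hb. destruct (dilation_radius r b Hr Hb) as [Hrb E].
          replace (polar_radial w r phi) with (polar_radial w (r / b * b) phi) by now rewrite E.
          rewrite <- (poisson_radial _ _ _ _ Pw) by lra.
          (* Moving s d/ds off the kernel [2 * KT] restores [P] and leaves the radial component of
             [w], which has boundary values. *)
          rewrite (polar_green_symmetric _ _ _ _ _ _ _ _ (r / b) b HP Pw) by lra.
          apply RInt_ext. intros t _. now rewrite Af by lra. }
      rewrite (RInt_ext _ (fun t => P r (t - phi) * g t)) in E
        by (intros t _; now rewrite Bf).
      unfold conv. rewrite E. field. lra.
    + assert (E : RInt (fun t => K r (t - phi) * f (cis t)) (- PI) PI
                  = PI * polar_angular w r phi).
      { apply (boundary_integral (fun s t => K s (t - phi)) f r); trivial.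
        - intros s t Hs. now apply (ph_cont_V _ _ _ _ HK).
        - intros b Hb. destruct (dilation_radius r b Hr Hb) as [Hrb E].
          rewrite (RInt_ext _ (fun t => K (r / b) (t - phi) * polar_radial w b t))
            by (intros t _; now rewrite Af by lra).
          (* On the kernel side s d/ds turns [K] into [- / 2 * PT]; the factor -1/2 meets the -2 PI
             of [poisson_angular] and leaves PI. *)
          rewrite <- (polar_green_symmetric _ _ _ _ _ _ _ _ (r / b) b HK Pw) by lra.
          rewrite (RInt_ext _ (fun t => - / 2 * (PT (r / b) (t - phi) * w (polar b t))))
            by (intros t _; apply Rmult_assoc).
          rewrite RInt_continuous_scal.
          + rewrite (poisson_angular _ _ _ _ Pw), E by lra.
            change (- / 2 * - (2 * PI * polar_angular w r phi) = PI * polar_angular w r phi).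
            field.
          + intros t. apply (continuous_mult (K := R_AbsRing)).
            * eapply is_derive_continuous, (is_derive_shift (PT (r / b))), is_derive_PT_t. lra.
            * apply (continuity_2d_pt_section_r (fun s t => w (polar s t))),
                (ph_cont_V _ _ _ _ Pw). lra. }
      rewrite (RInt_ext _ (fun t => K r (t - phi) * g t)) in E
        by (intros t _; now rewrite Bf).
      unfold conv. rewrite E. field. lra.
Qed.
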